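(* For every fixed $\epsilon>0$ there exists $d_0=d_0(\epsilon)$ such that for every fixed integer $d\ge d_0$, asymptotically almost surely a graph $G\in\mathcal{G}_{n,d}$ satisfies \[ n\left(1-(1+\epsilon)\frac{4\log d}{d}\right)\le Z(G)\le n\left(1-(1-\epsilon)\frac{\log d}{2d}\right). \]
   Context: $\mathcal{G}_{n,d}$ denotes the uniform probability space of (simple) $d$-regular graphs on $n$ labelled vertices, with $d$ fixed, $n\to\infty$, and $n$ even if $d$ is odd. An event holds asymptotically almost surely (a.a.s.) if its probability tends to $1$ as $n\to\infty$. $\log$ is the natural logarithm. Zero forcing: given a graph $G$ and an initial set $S$ of vertices coloured black (all others white), repeatedly, a black vertex with exactly one white neighbour forces that neighbour to become black; $S$ is a zero forcing set if eventually all vertices are black. $Z(G)$, the zero forcing number, is the minimum size of a zero forcing set of $G$. *)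

(* Defs.v *)
From mathcomp Require Import all_boot.
From Stdlib Require Import Reals.

Set Implicit Arguments.
Unset Strict Implicit.
Unset Printing Implicit Defensive.

(* A labelled graph on vertex set 'I_n, given by its neighbourhood function. *)
Definition graph (n : nat) := {ffun 'I_n -> {set 'I_n}}.

Definition simple_graph n (g : graph n) : bool :=
  [forall x, x \notin g x] && [forall x, forall y, (y \in g x) == (x \in g y)].

Definition regular_graph n (d : nat) (g : graph n) : bool :=
  simple_graph g && [forall x, #|g x| == d].

Definition force_step n (g : graph n) (B B' : {set 'I_n}) : bool :=
  [exists v in B, exists w, (g v :\: B == [set w]) && (B' == w |: B)].

Definition zero_forcing_set n (g : graph n) (S : {set 'I_n}) : bool :=
  connect (force_step g) S setT.

(* Zero forcing number: minimum size of a zero forcing set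
   (the whole vertex set is always one, so n is a valid default). *)
Definition zero_forcing_number n (g : graph n) : nat :=
  \big[minn/n]_(S : {set 'I_n} | zero_forcing_set g S) #|S|.

Definition prob_Gnd (n d : nat) (P : graph n -> bool) : R :=
  (INR #|[set g : graph n | regular_graph d g && P g]|
   / INR #|[set g : graph n | regular_graph d g]|)%R.

Definition Rleb (x y : R) : bool := if Rle_dec x y then true else false.

Definition aas (d : nat) (P : forall n, graph n -> bool) : Prop :=
  forall eta : R, (0 < eta)%R ->
    exists N : nat, forall n : nat, (N <= n)%N -> ~~ odd (n * d) ->
      (1 - eta <= @prob_Gnd n d (P n))%R.

(* Main.v *)
Require Import Defs.
From mathcomp Require Import all_boot.
From Stdlib Require Import Reals ZArith Lra.
(* The last import restores the MathComp meaning of [^] and [family], which Reals shadows. *)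
From mathcomp Require Import ssrnat finfun zify.

(** Both bounds reduce to facts about uniform simple d-regular graphs that are
    obtained by switching: replacing edges ax, yb by xy, ba, i.e. toggling the
    4-cycle a-x-y-b, is an involution, so switchings can be counted from either end.

    Lower bound.  A zero forcing set of size n - 2s yields disjoint sets A, B of
    size s with no edge between them: the vertices that have forced up to the moment
    when s white vertices are left, and these white vertices.  If c_j counts the
    graphs with j edges between A and B, switching gives
      (1 - o(1)) (ds)^2 c_j <= (j+1) nd c_(j+1) + (j+2)^2 c_(j+2),
    whence c_0 is at most about exp (- d s^2 / n) times the number of graphs.  For
    s = 2 (1 + eps) n ln d / d this beats the number of pairs (A, B), which is at
    most d^(2s).

    Upper bound.  Switching shows that only O(1) vertices are expected on cycles of
    length 3 or 4.  Colour the vertices uniformly with M = floor (2d / ln d) colours.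
    By Chebyshev's inequality nearly every vertex v of colour 0 off the short cycles
    has a neighbour u with no other vertex of colour 0 in N[u]; these v may all be
    white at the start, as each is forced at once by its u. *)

Set Implicit Arguments.
Unset Strict Implicit.
Unset Printing Implicit Defensive.

(** * Switchings *)

Section Switching.
Variables (n d : nat).
Implicit Types (g : graph n) (a b x y v w : 'I_n) (A B : {set 'I_n}).

Definition edge_eq a x v w := ((v == a) && (w == x)) || ((v == x) && (w == a)).

Definition cycle4 a x y b v w :=
  [|| edge_eq a x v w, edge_eq x y v w, edge_eq y b v w | edge_eq b a v w].

(** Taking symmetric differences with no side condition makes this an involution on all of
    [graph n]; only regularity of the result depends on [switchable]. *)
Definition toggle a x y b g : graph n :=
  [ffun v => [set w | (w \in g v) (+) cycle4 a x y b v w]].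

Definition switchable g a x y b :=
  [&& uniq [:: a; x; y; b], x \in g a, y \notin g x, b \in g y & b \notin g a].

Lemma in_toggle a x y b g v w :
  (w \in toggle a x y b g v) = (w \in g v) (+) cycle4 a x y b v w.
Proof. by rewrite ffunE inE. Qed.

Lemma toggleK a x y b : involutive (toggle a x y b).
Proof.
by move=> g; apply/ffunP=> v; apply/setP=> w; rewrite !in_toggle addbK.
Qed.

Lemma edge_eqC a x v w : edge_eq a x v w = edge_eq a x w v.
Proof. by rewrite /edge_eq orbC andbC [(w == x) && _]andbC. Qed.

Lemma cycle4C a x y b v w : cycle4 a x y b v w = cycle4 a x y b w v.
Proof. by rewrite /cycle4; do 4 rewrite edge_eqC; rewrite !(edge_eqC _ _ v). Qed.

Lemma simple_graphP g :
  reflect ((forall v, v \notin g v) /\ (forall v w, (w \in g v) = (v \in g w)))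
          (simple_graph g).
Proof.
apply: (iffP andP) => [[/forallP irr /forallP sym]|[irr sym]]; split=> //.
- by move=> v w; move/forallP: (sym v) => /(_ w)/eqP.
- exact/forallP.
- by apply/forallP=> v; apply/forallP=> w; rewrite sym.
Qed.

Lemma regular_graphP g :
  reflect [/\ forall v, v \notin g v, forall v w, (w \in g v) = (v \in g w)
            & forall v, #|g v| = d] (regular_graph d g).
Proof.
apply: (iffP andP) => [[/simple_graphP[irr sym] /forallP deg]|[irr sym deg]].
  by split=> // v; apply/eqP.
by split; [apply/simple_graphP|apply/forallP=> v; rewrite deg].
Qed.

Lemma card_exchange (S : {set 'I_n}) x b :
  x \in S -> b \notin S ->
  #|[set w | (w \in S) (+) ((w == x) || (w == b))]| = #|S|.
Proof.
move=> xS bS; have -> : [set w | (w \in S) (+) ((w == x) || (w == b))] = b |: (S :\ x).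
  apply/setP=> w; rewrite !inE.
  have [->|wx] := eqVneq w x; first by rewrite xS; case: eqVneq => // xb; rewrite -xb xS in bS.
  by have [->|wb] /= := eqVneq w b; rewrite ?(negbTE bS) ?addbF.
by rewrite cardsU1 !inE (negbTE bS) andbF add1n; rewrite [in RHS](cardsD1 x) xS.
Qed.

(** At each corner of the 4-cycle one of the two toggled pairs is an edge and the other is not, so
    the corner trades one neighbour for another ([card_exchange]). *)
Lemma regular_toggle a x y b g :
  regular_graph d g -> switchable g a x y b -> regular_graph d (toggle a x y b g).
Proof.
move=> /regular_graphP[irr sym deg] /and5P[/= uq xa yx by_ ab].
move: uq; rewrite !inE !negb_or -!andbA => /and5P[nax nay nab nxy /andP[nxb /andP[nyb _]]].
apply/regular_graphP; split.
- move=> v; rewrite in_toggle (negbTE (irr v)) /= /cycle4 /edge_eq.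
  case: eqVneq => [->|_]; first by rewrite (negbTE nax) (negbTE nay) (negbTE nab).
  case: eqVneq => [->|_]; first by rewrite (negbTE nxy) (negbTE nxb).
  by case: eqVneq => [->|_] //=; rewrite ?(negbTE nyb) ?andbF.
- by move=> v w; rewrite !in_toggle sym cycle4C.
move=> v; rewrite -[in RHS](deg v).
have rew (P : pred 'I_n) :
    (forall w, cycle4 a x y b v w = P w) ->
    toggle a x y b g v = [set w | (w \in g v) (+) P w].
  by move=> PE; apply/setP=> w; rewrite in_toggle inE PE.
have F := (negbTE nax, negbTE nay, negbTE nab, negbTE nxy, negbTE nxb, negbTE nyb).
have F' : ((x == a) = false) * ((y == a) = false) * ((b == a) = false)
        * ((y == x) = false) * ((b == x) = false) * ((b == y) = false).
  by do !split; rewrite eq_sym F.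
have [va|nva] := eqVneq v a.
  rewrite (rew (fun w => (w == x) || (w == b))) ?card_exchange ?va //.
  by move=> w; rewrite /cycle4 /edge_eq !(eqxx, F, F') /= ?orbF.
have [vx|nvx] := eqVneq v x.
  rewrite (rew (fun w => (w == a) || (w == y))) ?card_exchange ?vx //.
    by rewrite sym.
  by move=> w; rewrite /cycle4 /edge_eq !(eqxx, F, F') /= ?orbF.
have [vy|nvy] := eqVneq v y.
  rewrite (rew (fun w => (w == b) || (w == x))) ?card_exchange ?vy //.
    by rewrite sym.
  by move=> w; rewrite /cycle4 /edge_eq !(eqxx, F, F') /= ?orbF orbC.
have [vb|nvb] := eqVneq v b.
  rewrite (rew (fun w => (w == y) || (w == a))) ?card_exchange ?vb //; try by rewrite sym.
  by move=> w; rewrite /cycle4 /edge_eq !(eqxx, F, F') /= ?orbF.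
congr #|pred_of_set _|; apply/setP=> w; rewrite in_toggle /cycle4 /edge_eq.
by rewrite (negbTE nva) (negbTE nvx) (negbTE nvy) (negbTE nvb) addbF.
Qed.

(** The label t names a switching and whatever else is to be remembered. For fixed t the toggle is
    injective and maps the graphs counted by F into those counted by F'. *)
Lemma switching_count (D : finType) (qa qx qy qb : D -> 'I_n)
    (F F' : graph n -> D -> bool) :
  (forall g t, regular_graph d g -> F g t ->
     switchable g (qa t) (qx t) (qy t) (qb t)
     && F' (toggle (qa t) (qx t) (qy t) (qb t) g) t) ->
  \sum_(g : graph n | regular_graph d g) \sum_(t : D) F g t
  <= \sum_(g : graph n | regular_graph d g) \sum_(t : D) F' g t.
Proof.
move=> FF'; rewrite exchange_big [leqRHS]exchange_big; apply: leq_sum => t _ /=.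
have cardE (P : pred (graph n)) :
    \sum_(g | regular_graph d g) P g = #|[set g | regular_graph d g && P g]|.
  by rewrite -sum1dep_card [RHS]big_mkcondr; apply: eq_bigr => g _; case: (P g).
rewrite !cardE -(card_imset _ (inv_inj (toggleK (qa t) (qx t) (qy t) (qb t)))).
apply/subset_leq_card/subsetP=> _ /imsetP[g + ->].
rewrite !inE => /andP[reg_g Fg].
by case/andP: (FF' g t reg_g Fg) => sw ->; rewrite regular_toggle.
Qed.

End Switching.

(** * Edges between two sets *)

Section EdgesBetween.
Variables (n d : nat).
Implicit Types (g : graph n) (a b x y v w : 'I_n) (A B : {set 'I_n}).

Definition edges_between g A B := \sum_(v in A) \sum_(w in B) (w \in g v).

Lemma sum_nat_pred (T : finType) (P : pred T) : \sum_(x : T) P x = #|P|.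
Proof.
by rewrite -sum1_card [RHS]big_mkcond /=; apply: eq_bigr => x _; rewrite unfold_in; case: (P x).
Qed.

Lemma sum_in_pred (T : finType) (A : {set T}) (P : pred T) :
  \sum_(x in A) P x = \sum_(x : T) ((x \in A) && P x).
Proof. by rewrite big_mkcond; apply: eq_bigr => x _; case: (x \in A). Qed.

Lemma sum_and (T : finType) (b : bool) (P : pred T) :
  \sum_(x : T) (b && P x) = b * \sum_(x : T) P x.
Proof. by rewrite big_distrr /=; apply: eq_bigr => x _; rewrite mulnb. Qed.

(** A dart is an edge with an orientation; each vertex is the tail of d darts. *)
Lemma sum_darts g (P : pred 'I_n) : regular_graph d g ->
  \sum_(e : 'I_n * 'I_n) (P e.1 && (e.2 \in g e.1)) = #|P| * d.
Proof.
move=> /regular_graphP[_ _ deg].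
rewrite -(pair_bigA _ (fun v w => P v && (w \in g v) : nat)) -sum_nat_pred big_distrl /=.
by apply: eq_bigr => v _; rewrite sum_and sum_nat_pred deg.
Qed.

Lemma sum_darts_rev g (P : pred 'I_n) : regular_graph d g ->
  \sum_(e : 'I_n * 'I_n) (P e.2 && (e.2 \in g e.1)) = #|P| * d.
Proof.
move=> reg; rewrite -(sum_darts _ reg).
have /regular_graphP[_ sym _] := reg.
rewrite -(pair_bigA _ (fun v w => P w && (w \in g v) : nat)).
rewrite -[RHS](pair_bigA _ (fun v w => P v && (w \in g v) : nat)) exchange_big.
by apply: eq_bigr => w _; apply: eq_bigr => v _; rewrite sym.
Qed.

Lemma edges_betweenE g A B :
  edges_between g A B =
  \sum_(e : 'I_n * 'I_n) [&& e.1 \in A, e.2 \in B & e.2 \in g e.1].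
Proof.
rewrite -(pair_bigA _ (fun v w => [&& v \in A, w \in B & w \in g v] : nat)).
rewrite /edges_between big_mkcond /=; apply: eq_bigr => v _.
by rewrite sum_and sum_in_pred; case: (v \in A); rewrite ?mul1n.
Qed.

Lemma edges_betweenC g A B : regular_graph d g ->
  edges_between g A B = edges_between g B A.
Proof.
move=> /regular_graphP[_ sym _]; rewrite /edges_between exchange_big.
by apply: eq_bigr => w _; apply: eq_bigr => v _; rewrite sym.
Qed.

(** The side conditions keep the removed edges ax and yb from joining A to B. The new edge ab does
    join them, and xy does so exactly when x is in A and y in B. *)
Lemma edges_between_toggle g A B a x y b :
  [disjoint A & B] -> switchable g a x y b ->
  [&& a \in A, b \in B, x \notin B & y \notin A] ->
  edges_between (toggle a x y b g) A B
  = (edges_between g A B).+1 + ((x \in A) && (y \in B)).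
Proof.
move=> dAB /and5P[uq xa yx by_ ab] /and4P[aA bB xB yA].
have aB : a \notin B by rewrite (disjointFr dAB).
have bA : b \notin A by rewrite (disjointFl dAB).
have -> : (edges_between g A B).+1 + ((x \in A) && (y \in B)) =
  \sum_(v in A) \sum_(w in B)
    ((w \in g v) + ((v == a) && (w == b)) + ((v == x) && (w == y))).
  have one p q : \sum_(v in A) \sum_(w in B) ((v == p) && (w == q)) = ((p \in A) && (q \in B)).
    rewrite (eq_bigr (fun v => (v == p) * (q \in B))); last first.
      move=> v _; rewrite sum_in_pred.
      under eq_bigr do rewrite andbCA.
      rewrite sum_and; congr (_ * _); rewrite (bigD1 q) //= eqxx andbT big1 ?addn0 //.
      by move=> w /negbTE->; rewrite andbF.
    rewrite -big_distrl /= -mulnb; congr (_ * _).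
    rewrite sum_in_pred (bigD1 p) //= eqxx andbT big1 ?addn0 //.
    by move=> w /negbTE->; rewrite andbF.
  under [RHS]eq_bigr do rewrite !big_split.
  by rewrite !big_split /= !one aA bB addn1.
have nax : a != x by apply: contraTneq uq => ->; rewrite /= !inE eqxx.
apply: eq_bigr => v vA; apply: eq_bigr => w wB; rewrite in_toggle /cycle4 /edge_eq.
have -> : (w == x) = false by apply: contraNF xB => /eqP<-.
have -> : (w == a) = false by apply: contraNF aB => /eqP<-.
have -> : (v == y) = false by apply: contraNF yA => /eqP<-.
have -> : (v == b) = false by apply: contraNF bA => /eqP<-.
rewrite !andbF /= orbF.
have [->|nva] := eqVneq v a.
  rewrite (negbTE nax) /=; have [->|_] := eqVneq w b; last by case: (_ \in _).
  by rewrite (negbTE ab).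
have [->|_] := eqVneq v x; last by case: (_ \in _).
by have [->|_] := eqVneq w y; rewrite ?(negbTE yx) //=; case: (_ \in _).
Qed.

End EdgesBetween.

Section EdgeCountRecursion.
Variables (n d s : nat) (A B : {set 'I_n}).
Hypotheses (dAB : [disjoint A & B]) (cardA : #|A| = s) (cardB : #|B| = s).
Implicit Types (g : graph n) (j : nat).

Definition num_regular := #|[set g : graph n | regular_graph d g]|.
Definition num_between j := #|[set g : graph n | regular_graph d g && (edges_between g A B == j)]|.

Let dart := ('I_n * 'I_n)%type.

(** Pairs of darts ax out of A and by out of B that admit the switch to ab and xy. Requiring j edges
    inside the predicate lets a sum over all regular graphs select the class counted by c_j. *)
Let forward g j (t : dart * dart) :=
  let: ((a, x), (b, y)) := t in
  (edges_between g A B == j) &&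
  [&& a \in A, x \in g a, x \notin B, b \in B, y \in g b & y \notin A] &&
  [&& b \notin g a, x != y & y \notin g x].

(** Of the (sd)^2 pairs of darts, those with x in B or y in A number at most j sd each. Those with b
    adjacent to a, x = y, or y adjacent to x number at most s d^3, s d^2 and s d^3, since a given
    first dart has few bad partners. *)
Lemma forward_count g j : regular_graph d g -> edges_between g A B = j ->
  (s * d) ^ 2 <= \sum_t forward g j t + (2 * j * (s * d) + 3 * s * d ^ 3).
Proof.
move=> reg gj; have /regular_graphP[_ sym deg] := reg.
pose WA (e : dart) := (e.1 \in A) && (e.2 \in g e.1).
pose WB (e : dart) := (e.1 \in B) && (e.2 \in g e.1).
have sumA : \sum_e WA e = s * d by rewrite -cardA -(sum_darts _ reg).
have sumB : \sum_e WB e = s * d by rewrite -cardB -(sum_darts _ reg).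
have sumAB : \sum_e (WA e && (e.2 \in B)) = j.
  rewrite -gj edges_betweenE; apply: eq_bigr => e _.
  by rewrite /WA; case: (_ \in A) => //=; rewrite andbC.
have sumBA : \sum_e (WB e && (e.2 \in A)) = j.
  rewrite -gj (edges_betweenC _ _ reg) edges_betweenE; apply: eq_bigr => e _.
  by rewrite /WB; case: (_ \in B) => //=; rewrite andbC.
have -> : (s * d) ^ 2 = \sum_(t : dart * dart) WA t.1 * WB t.2.
  rewrite -(pair_bigA _ (fun e f => WA e * WB f)) -mulnn -{1}sumA big_distrl /=.
  by apply: eq_bigr => e _; rewrite -sumB big_distrr.
have bound1 : \sum_(t : dart * dart) (WA t.1 && (t.1.2 \in B)) * WB t.2 <= j * (s * d).
  rewrite -(pair_bigA _ (fun e f => (WA e && (e.2 \in B)) * WB f)) /=.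
  by under eq_bigr do rewrite -big_distrr; rewrite -big_distrl /= sumAB sumB.
have bound2 : \sum_(t : dart * dart) WA t.1 * (WB t.2 && (t.2.2 \in A)) <= j * (s * d).
  rewrite -(pair_bigA _ (fun e f => WA e * (WB f && (f.2 \in A)))) /=.
  by under eq_bigr do rewrite -big_distrr; rewrite -big_distrl /= sumBA sumA mulnC.
have bound (K : nat) (Q : dart -> dart -> bool) :
    (forall e, \sum_f Q e f <= K) ->
    \sum_(t : dart * dart) WA t.1 * Q t.1 t.2 <= s * d * K.
  move=> QK; rewrite -(pair_bigA _ (fun e f => WA e * Q e f)) /= -sumA big_distrl /=.
  by apply: leq_sum => e _; rewrite -big_distrr leq_mul.
have bound3 : \sum_(t : dart * dart) WA t.1 * ((t.2.1 \in g t.1.1) && (t.2.2 \in g t.2.1)) <= s * d * (d * d).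
  apply: (bound _ (fun e f => (f.1 \in g e.1) && (f.2 \in g f.1))) => e.
  by rewrite (sum_darts _ reg) deg.
have bound4 : \sum_(t : dart * dart) WA t.1 * ((t.2.2 == t.1.2) && (t.2.2 \in g t.2.1)) <= s * d * (1 * d).
  apply: (bound _ (fun e f => (f.2 == e.2) && (f.2 \in g f.1))) => e.
  by rewrite (sum_darts_rev (pred1 e.2) reg) card1.
have bound5 : \sum_(t : dart * dart) WA t.1 * ((t.2.2 \in g t.1.2) && (t.2.2 \in g t.2.1)) <= s * d * (d * d).
  apply: (bound _ (fun e f => (f.2 \in g e.2) && (f.2 \in g f.1))) => e.
  by rewrite (sum_darts_rev (fun v => v \in g e.2) reg) deg.
have le_sum : \sum_(t : dart * dart) WA t.1 * WB t.2 <=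
  \sum_t forward g j t
  + (\sum_(t : dart * dart) (WA t.1 && (t.1.2 \in B)) * WB t.2
  + (\sum_(t : dart * dart) WA t.1 * (WB t.2 && (t.2.2 \in A))
  + (\sum_(t : dart * dart) WA t.1 * ((t.2.1 \in g t.1.1) && (t.2.2 \in g t.2.1))
  + (\sum_(t : dart * dart) WA t.1 * ((t.2.2 == t.1.2) && (t.2.2 \in g t.2.1))
  + \sum_(t : dart * dart) WA t.1 * ((t.2.2 \in g t.1.2) && (t.2.2 \in g t.2.1)))))).
  rewrite -!big_split; apply: leq_sum => -[[a x] [b y]] _.
  rewrite /forward /WA /WB /= gj eqxx /= (eq_sym y).
  case: (a \in A) (x \in g a) (b \in B) (y \in g b) => [] [] [] [] //=.
  by case: (x \in B) (y \in A) (b \in g a) (y \in g x) (x == y) => [] [] [] [] [].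
apply: leq_trans le_sum _; rewrite leq_add2l.
have dd : s * d * d <= s * d * d ^ 2 by case: (d) => // m; rewrite leq_mul // leq_pmulr.
rewrite !expnS expn0 in dd *; nia.
Qed.

(** Regroups the endpoints of the old edges ax, by into the new edges ab, xy, over which the reverse
    switchings are counted. *)
Lemma sum4_swap (F : 'I_n -> 'I_n -> 'I_n -> 'I_n -> nat) :
  \sum_(t : dart * dart) F t.1.1 t.1.2 t.2.1 t.2.2
  = \sum_(p : dart) \sum_(q : dart) F p.1 q.1 p.2 q.2.
Proof.
rewrite -(pair_bigA _ (fun e f : dart => F e.1 e.2 f.1 f.2)) /=.
rewrite -(pair_bigA _ (fun a x => \sum_f F a x f.1 f.2)) /=.
rewrite -(pair_bigA _ (fun a b => \sum_(q : dart) F a q.1 b q.2)) /=.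
apply: eq_bigr => a _.
under eq_bigr => x _ do rewrite -(pair_bigA _ (fun b y => F a x b y)) /=.
rewrite exchange_big /=; apply: eq_bigr => b _.
by rewrite -(pair_bigA _ (fun x y => F a x b y)).
Qed.

(** Possible results of a switch: here xy is an arbitrary dart, leaving j nd choices; in [backward2]
    it also joins A to B, leaving j^2. *)
Let backward1 g j (t : dart * dart) :=
  let: ((a, x), (b, y)) := t in
  (edges_between g A B == j) && ([&& a \in A, b \in B & b \in g a] && (y \in g x)).

Let backward2 g j (t : dart * dart) :=
  let: ((a, x), (b, y)) := t in
  (edges_between g A B == j) &&
  ([&& a \in A, b \in B & b \in g a] && [&& x \in A, y \in B & y \in g x]).

Lemma backward1_count g j : regular_graph d g ->
  \sum_t backward1 g j t = (edges_between g A B == j) * (j * (n * d)).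
Proof.
move=> reg; rewrite (eq_bigr (fun t : dart * dart => backward1 g j ((t.1.1, t.1.2), (t.2.1, t.2.2)) : nat)); last by move=> [[? ?] [? ?]] _.
rewrite (sum4_swap (fun a x b y => backward1 g j ((a, x), (b, y)))) /=.
have [gj|_] := eqVneq; last by rewrite big1 // => p _; rewrite big1.
rewrite mul1n -{1}gj edges_betweenE big_distrl /=; apply: eq_bigr => p _.
rewrite sum_and; congr (_ * _).
by rewrite -[n in RHS]card_ord -(sum_darts _ reg).
Qed.

Lemma backward2_count g j :
  \sum_t backward2 g j t = (edges_between g A B == j) * j ^ 2.
Proof.
rewrite (eq_bigr (fun t : dart * dart => backward2 g j ((t.1.1, t.1.2), (t.2.1, t.2.2)) : nat)); last by move=> [[? ?] [? ?]] _.
rewrite (sum4_swap (fun a x b y => backward2 g j ((a, x), (b, y)))) /=.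
have [gj|_] := eqVneq; last by rewrite big1 // => p _; rewrite big1.
rewrite mul1n -mulnn -{1}gj edges_betweenE big_distrl /=; apply: eq_bigr => p _.
by rewrite sum_and -gj edges_betweenE.
Qed.

Lemma sum_num_between j : \sum_(g | regular_graph d g) (edges_between g A B == j) = num_between j.
Proof. by rewrite /num_between -sum1dep_card [RHS]big_mkcondr /=; apply: eq_bigr => g _; case: (_ == j). Qed.

(* A switch creates the A-B edge ab, and possibly a second one, xy. *)
Lemma num_between_recursion j :
  (s * d) ^ 2 * num_between j <=
  (2 * j * (s * d) + 3 * s * d ^ 3) * num_between j
  + j.+1 * (n * d) * num_between j.+1 + j.+2 ^ 2 * num_between j.+2.
Proof.
have lower : (s * d) ^ 2 * num_between j <=
    \sum_(g | regular_graph d g) \sum_t forward g j t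
    + (2 * j * (s * d) + 3 * s * d ^ 3) * num_between j.
  rewrite -sum_num_between !big_distrr -big_split; apply: leq_sum => g reg /=.
  have [gj|_] := eqVneq; last by rewrite !muln0.
  by rewrite !muln1 forward_count.
pose qa (t : dart * dart) := t.1.1. pose qx (t : dart * dart) := t.1.2.
pose qb (t : dart * dart) := t.2.1. pose qy (t : dart * dart) := t.2.2.
have forward_sw g t : regular_graph d g -> forward g j t ->
    switchable g (qa t) (qx t) (qy t) (qb t) /\
    [&& qa t \in A, qb t \in B, qx t \notin B & qy t \notin A].
  case: t => [[a x] [b y]] /regular_graphP[irr sym _] /andP[/andP[_]].
  rewrite /qa /qx /qy /qb /=.
  move=> /and5P[aA xa xB bB /andP[yb yA]] /and3P[ba xy yx]; split; last by rewrite aA bB xB.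
  rewrite /switchable xa yx ba sym yb /= !inE !negb_or xy !andbT -!andbA.
  apply/and5P; split.
  - by apply: contraTneq xa => <-.
  - by apply: contraTneq aA => ->.
  - by apply: contraTneq bB => <-; rewrite (disjointFr dAB).
  - by [].
  - apply/andP; split; first by apply: contraTneq bB => <-.
    by apply: contraTneq yb => ->.
pose F1 g t := forward g j t && ~~ ((qx t \in A) && (qy t \in B)).
pose F2 g t := forward g j t && ((qx t \in A) && (qy t \in B)).
have split_forward : \sum_(g | regular_graph d g) \sum_t forward g j t =
    \sum_(g | regular_graph d g) \sum_t F1 g t + \sum_(g | regular_graph d g) \sum_t F2 g t.
  rewrite -big_split; apply: eq_bigr => g _; rewrite -big_split; apply: eq_bigr => t _.
  by rewrite /F1 /F2; case: (forward g j t); case: ((qx t \in A) && _).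
have upper1 : \sum_(g | regular_graph d g) \sum_t F1 g t <= j.+1 * (n * d) * num_between j.+1.
  apply: leq_trans (switching_count (qa := qa) (qx := qx) (qy := qy) (qb := qb)
    (F' := fun g t => backward1 g j.+1 t) _) _.
    move=> g t reg /andP[fw xyAB].
    have [sw tAB] := forward_sw g t reg fw; rewrite sw /=.
    have := edges_between_toggle dAB sw tAB.
    have /regular_graphP[_ sym _] := regular_toggle reg sw.
    move: fw sw tAB xyAB sym; case: t => [[a x] [b y]]; rewrite /qa /qx /qy /qb /=.
    move=> /andP[/andP[/eqP-> _] _] /and5P[uq xa yx by_ ba] /and4P[aA bB _ _] /negbTE-> sym ->.
    rewrite addn0 eqxx aA bB !in_toggle (negbTE ba) (negbTE yx) /cycle4 /edge_eq.
    by rewrite !eqxx /= !orbT.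
  rewrite (eq_bigr (fun g => (edges_between g A B == j.+1) * (j.+1 * (n * d)))).
    by rewrite -big_distrl /= sum_num_between mulnC.
  by move=> g reg; rewrite backward1_count.
have upper2 : \sum_(g | regular_graph d g) \sum_t F2 g t <= j.+2 ^ 2 * num_between j.+2.
  apply: leq_trans (switching_count (qa := qa) (qx := qx) (qy := qy) (qb := qb)
    (F' := fun g t => backward2 g j.+2 t) _) _.
    move=> g t reg /andP[fw xyAB].
    have [sw tAB] := forward_sw g t reg fw; rewrite sw /=.
    have := edges_between_toggle dAB sw tAB.
    move: fw sw tAB xyAB; case: t => [[a x] [b y]]; rewrite /qa /qx /qy /qb /=.
    move=> /andP[/andP[/eqP-> _] _] /and5P[uq xa yx by_ ba] /and4P[aA bB _ _] xyAB ->.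
    have /andP[xA yB] := xyAB.
    rewrite xyAB addn1 eqxx aA bB xA yB !in_toggle (negbTE ba) (negbTE yx) /cycle4 /edge_eq.
    by rewrite !eqxx /= !orbT.
  rewrite (eq_bigr (fun g => (edges_between g A B == j.+2) * j.+2 ^ 2)).
    by rewrite -big_distrl /= sum_num_between mulnC.
  by move=> g reg; rewrite backward2_count.
apply: leq_trans lower _; rewrite split_forward.
by rewrite addnC -addnA leq_add2l leq_add.
Qed.

End EdgeCountRecursion.

(** * Short cycles *)

Lemma sum_pair (S T : finType) (F : S * T -> nat) :
  \sum_t F t = \sum_x \sum_y F (x, y).
Proof. by rewrite pair_bigA; apply: eq_bigr => -[]. Qed.

Section ShortCycles.
Variables (n d : nat).
Implicit Types (g : graph n) (v u w : 'I_n).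

(** The common vertex w of the two closed neighbourhoods closes a triangle if it is u1 or u2, and a
    4-cycle otherwise. This form is what [disjoint_block] contradicts. *)
Definition on_short_cycle g v :=
  [exists u1 in g v, exists u2 in g v, exists w,
    [&& u1 != u2, w != v, w \in u1 |: g u1 & w \in u2 |: g u2]].

Let dart := ('I_n * 'I_n)%type.

Let short g (t : dart * dart) :=
  let: ((v, u), (u', w)) := t in
  [&& u \in g v, u' \in g v, u != u', w != v, w \in g u' & (w == u) || (w \in g u)].

Lemma on_short_cycleP g v : regular_graph d g -> on_short_cycle g v ->
  exists u u' w, short g ((v, u), (u', w)).
Proof.
move=> /regular_graphP[irr sym _] /existsP[u /andP[uv /existsP[u' /andP[u'v /existsP[w]]]]].
move=> /and4P[uu' wv]; rewrite !inE => wu wu'.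
have [wE|wNu'] := eqVneq w u'.
  (* Here w = u', so the cycle is a triangle; exchanging u and u' makes w the endpoint of the edge
     to be switched. *)
  exists u', u, u'; rewrite /short uv u'v eq_sym uu' -{1}wE wv eqxx /= andbT.
  by move: wu; rewrite wE eq_sym (negbTE uu').
by exists u, u', w; rewrite /short uv u'v uu' wv wu andbT; rewrite (negbTE wNu') in wu'.
Qed.

Lemma card_on_short_cycle g : regular_graph d g ->
  #|[set v | on_short_cycle g v]| <= \sum_t short g t.
Proof.
move=> reg; rewrite -sum1dep_card big_mkcond /=.
have -> : \sum_t short g t = \sum_v \sum_u \sum_u' \sum_w short g ((v, u), (u', w)).
  by rewrite !sum_pair; do 2 (apply: eq_bigr => ? _); rewrite sum_pair.
apply: leq_sum => v _; case: ifP => // /(on_short_cycleP reg)[u [u' [w shortt]]].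
have le_term (T : finType) (F : T -> nat) x : F x <= \sum_y F y by rewrite (bigD1 x) //= leq_addr.
have : 1 <= short g ((v, u), (u', w)) by rewrite shortt.
move=> /leq_trans; apply.
apply: leq_trans (le_term _ (fun u => \sum_u' \sum_w short g ((v, u), (u', w))) u).
apply: leq_trans (le_term _ (fun u' => \sum_w short g ((v, u), (u', w))) u').
exact: (le_term _ (fun w => short g ((v, u), (u', w)) : nat) w).
Qed.

(** The dart yb avoids K so that vu and yb can be switched without touching the path v, u', w, u. *)
Let forward g (t : (dart * dart) * dart) :=
  let: (((v, u), (u', w)), (y, b)) := t in
  short g ((v, u), (u', w)) &&
  let K := [set v; w] :|: (g v :|: g u) in [&& b \in g y, y \notin K & b \notin K].

Let backward g (t : (dart * dart) * dart) :=
  let: (((v, u), (u', w)), (y, b)) := t in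
  [&& u' \in g v, w \in g u' & (u == w) || (u \in g w)] && ((y \in g u) && (b \in g v)).

(** K has at most 2(d+1) vertices, and each is the tail of d darts and the head of d darts, so at
    most 4(d+1)d darts are lost. *)
Lemma forward_short_count g : regular_graph d g ->
  n * d * \sum_t short g t
  <= \sum_t forward g t + 4 * d.+1 * d * \sum_t short g t.
Proof.
move=> reg; have /regular_graphP[_ sym deg] := reg.
rewrite [X in _ <= X + _]sum_pair !big_distrr -big_split.
apply: leq_sum => -[[v u] [u' w]] _.
have [shortt|_] := boolP (short g ((v, u), (u', w))); last by rewrite /= !muln0.
rewrite /= !muln1; set K := [set v; w] :|: (g v :|: g u).
have cardK : #|K| <= 2 * d.+1.
  have : #|[set v; w]| <= 2 by rewrite cards2; case: (v != w).
  have := (leq_card_setU [set v; w] (g v :|: g u)).1; have := (leq_card_setU (g v) (g u)).1.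
  rewrite -/K !deg => h1 h2 h3; apply: leq_trans h2 (leq_trans (leq_add h3 h1) _).
  by rewrite addnn -mul2n mulnS.
have total : \sum_(e : dart) (e.2 \in g e.1) = n * d.
  by rewrite -[n in RHS]card_ord -(sum_darts _ reg).
rewrite -total.
apply: (@leq_trans (\sum_(e : dart) [&& e.2 \in g e.1, e.1 \notin K & e.2 \notin K]
   + (\sum_(e : dart) ((e.1 \in K) && (e.2 \in g e.1))
   + \sum_(e : dart) ((e.2 \in K) && (e.2 \in g e.1))))).
  rewrite -!big_split; apply: leq_sum => e _ /=.
  by case: (e.1 \in K) (e.2 \in K) (e.2 \in g e.1) => [] [] [].
rewrite leq_add //; first by apply: leq_sum => -[y b] _; move: shortt => /= ->.
rewrite (sum_darts (fun v => v \in K) reg) (sum_darts_rev (fun v => v \in K) reg).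
by rewrite -mulnDl addnn -mul2n leq_mul2r -[4]/(2 * 2) -mulnA leq_mul ?orbT.
Qed.

(** There are n choices for v, d each for u', w, y and b, and d+1 for u, which is w or a neighbour
    of w. *)
Lemma backward_short_count g : regular_graph d g ->
  \sum_t backward g t <= n * d ^ 4 * d.+1.
Proof.
move=> reg; have /regular_graphP[_ sym deg] := reg.
rewrite sum_pair.
rewrite (eq_bigr (fun t : dart * dart => 
  [&& t.2.1 \in g t.1.1, t.2.2 \in g t.2.1 & (t.1.2 == t.2.2) || (t.1.2 \in g t.2.2)] * (d * d))); last first.
  move=> [[v u] [u' w]] _ /=; rewrite sum_pair /=.
  under eq_bigr do under eq_bigr do rewrite andbA.
  under eq_bigr do rewrite sum_and sum_nat_pred deg -mulnb -mulnA.
  by rewrite -big_distrr -big_distrl /= sum_nat_pred deg.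
rewrite -big_distrl /=.
rewrite -(pair_bigA _ (fun e f : dart => [&& f.1 \in g e.1, f.2 \in g f.1 & (e.2 == f.2) || (e.2 \in g f.2)] : nat)) /=.
rewrite -(pair_bigA _ (fun v u => \sum_(f : dart) [&& f.1 \in g v, f.2 \in g f.1 & (u == f.2) || (u \in g f.2)])) /=.
have -> : n * d ^ 4 * d.+1 = \sum_(v : 'I_n) (d * d * d.+1) * (d * d).
  by rewrite sum_nat_const card_ord !expnS expn0; nia.
rewrite big_distrl; apply: leq_sum => v _ /=; rewrite leq_mul2r; apply/orP; right.
have card_in (S : {set 'I_n}) : \sum_u (u \in S) = #|S| by exact: (sum_nat_pred (mem S)).
have one x : \sum_(u : 'I_n) (u == x) = 1 by rewrite (sum_nat_pred (pred1 x)) card1.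
rewrite exchange_big /=.
apply: (@leq_trans (\sum_(f : dart) ((f.1 \in g v) && (f.2 \in g f.1)) * d.+1)).
  apply: leq_sum => f _; under eq_bigr do rewrite andbA.
  rewrite sum_and leq_mul // -add1n -(deg f.2) -(one f.2) -card_in -big_split.
  by apply: leq_sum => u _ /=; case: eqVneq.
by rewrite -big_distrl /= (sum_darts (fun w => w \in g v) reg) deg.
Qed.

Lemma cycle4_out a x y b v w : v \notin [:: a; x; y; b] -> cycle4 a x y b v w = false.
Proof.
rewrite !inE !negb_or => /and4P[/negbTE va /negbTE vx /negbTE vy /negbTE vb].
by rewrite /cycle4 /edge_eq va vx vy vb.
Qed.

(* Switching the edge vu of a short cycle through v with a far edge keeps the rest
   of the cycle, a path from v to u; such paths are few. *)
Lemma sum_short_cycles :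
  n * d * \sum_(g | regular_graph d g) \sum_t short g t
  <= num_regular n d * (n * d ^ 4 * d.+1)
     + 4 * d.+1 * d * \sum_(g | regular_graph d g) \sum_t short g t.
Proof.
apply: (@leq_trans (\sum_(g | regular_graph d g) \sum_t forward g t
   + 4 * d.+1 * d * \sum_(g | regular_graph d g) \sum_t short g t)).
  rewrite !big_distrr -big_split; apply: leq_sum => g reg /=.
  exact: forward_short_count.
rewrite leq_add2r.
pose qa (t : (dart * dart) * dart) := t.1.1.1. pose qx (t : (dart * dart) * dart) := t.1.1.2.
pose qb (t : (dart * dart) * dart) := t.2.2. pose qy (t : (dart * dart) * dart) := t.2.1.
apply: leq_trans (switching_count (qa := qa) (qx := qx) (qy := qy) (qb := qb)
    (F' := backward) _) _; last first.
  rewrite /num_regular -sum1dep_card big_distrl /=; apply: leq_sum => g reg.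
  by rewrite mul1n backward_short_count.
move=> g [[[v u] [u' w]] [y b]]; rewrite /qa /qx /qb /qy /= => /regular_graphP[irr sym deg].
move=> /andP[/and5P[uv u'v uu' wv /andP[wu' wu]] /and3P[yb]].
rewrite !inE !negb_or => /andP[/andP[yv yw] /andP[yNv yNu]] /andP[/andP[bv bw] /andP[bNv bNu]].
have neq z : (z \in g v) -> v != z by move=> zv; apply: contraTneq zv => <-.
have yu : y != u by apply: contraNneq yNv => ->.
have bu : b != u by apply: contraNneq bNv => ->.
have sw : switchable g v u y b.
  rewrite /switchable uv yNu yb bNv /= !inE !negb_or neq //= (eq_sym v) yv (eq_sym v) bv.
  rewrite (eq_sym u) yu (eq_sym u) bu !andbT /=.
  by apply: contraTneq yb => ->.
rewrite sw /=.
(* The inner vertices u' and w of the path are not corners of the switch, so the path survives. *)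
have out' : u' \notin [:: v; u; y; b].
  rewrite !inE !negb_or (eq_sym u' v) neq // (eq_sym u' u) uu' /=.
  by apply/andP; split; [apply: contraNneq yNv => <-|apply: contraNneq bNv => <-].
rewrite !in_toggle (cycle4_out _ out') (cycle4C _ _ _ _ v u') (cycle4_out _ out') !addbF u'v wu' /=.
apply/and3P; split.
- have [->|wNu] := eqVneq u w; first by [].
  have outw : w \notin [:: v; u; y; b].
    by rewrite !inE !negb_or wv (eq_sym w u) wNu (eq_sym w y) yw (eq_sym w b) bw.
  rewrite (cycle4_out _ outw) addbF; move: wu; rewrite eq_sym (negbTE wNu) /=.
  by rewrite sym.
- by rewrite (negbTE yNu) /cycle4 /edge_eq !eqxx /= !orbT.
- by rewrite (negbTE bNv) /cycle4 /edge_eq !eqxx /= !orbT.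
Qed.

(** Every vertex on a short cycle carries a [short] tuple. For n large against d this bounds the
    mean number of such vertices independently of n. *)
Lemma sum_on_short_cycle :
  (n * d - 4 * d.+1 * d) *
    \sum_(g : graph n | regular_graph d g) #|[set v | on_short_cycle g v]|
  <= num_regular n d * (n * d ^ 4 * d.+1).
Proof.
have le_short : \sum_(g : graph n | regular_graph d g) #|[set v | on_short_cycle g v]|
    <= \sum_(g | regular_graph d g) \sum_t short g t.
  by apply: leq_sum => g; apply: card_on_short_cycle.
apply: leq_trans (leq_mul (leqnn _) le_short) _.
by rewrite mulnBl leq_subLR addnC sum_short_cycles.
Qed.

End ShortCycles.

(** * Zero forcing *)

Section ZeroForcing.
Variable n : nat.
Implicit Types (g : graph n) (u v w : 'I_n) (A B S W : {set 'I_n}).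

Lemma zero_forcing_number_le g S :
  zero_forcing_set g S -> zero_forcing_number g <= #|S|.
Proof.
move=> zS; rewrite /zero_forcing_number.
have : S \in index_enum {set 'I_n} by rewrite mem_index_enum.
elim: (index_enum _) => //= T r IH; rewrite inE big_cons => /orP[/eqP <-|Sr].
  by rewrite zS geq_minl.
by case: ifP => _; [apply: leq_trans (geq_minr _ _) _|]; apply: IH.
Qed.

(** The bound k <= n takes care of the default value n of the minimum. *)
Lemma zero_forcing_number_ge g k : k <= n ->
  (forall S, zero_forcing_set g S -> k <= #|S|) -> k <= zero_forcing_number g.
Proof.
move=> kn kS; rewrite /zero_forcing_number; elim/big_ind: _ => //.
by move=> x y kx ky; rewrite leq_min kx.
Qed.

Lemma force_stepP g S S' : force_step g S S' ->
  exists v w, [/\ v \in S, g v :\: S = [set w] & S' = w |: S].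
Proof.
by move=> /existsP[v /andP[vS /existsP[w /andP[/eqP gv /eqP ->]]]]; exists v, w.
Qed.

(** Peels off the last step of the path, which suits invariants of forcing from a fixed starting
    set. *)
Lemma connect_rcons_ind (T : finType) (e : rel T) (P : T -> Prop) x :
  P x -> (forall y z, connect e x y -> P y -> e y z -> P z) ->
  forall y, connect e x y -> P y.
Proof.
move=> Px step y /connectP[p + ->]; elim/last_ind: p => [//|p z IH].
rewrite rcons_path last_rcons => /andP[ep ez].
by apply: step ez; [apply/connectP; exists p|apply: IH].
Qed.

(** Known as a bipartite hole. *)
Definition hole g A B := [disjoint A & B] && [forall a in A, g a :&: B == set0].

Lemma card_force_step g S S' : force_step g S S' -> #|S'| = #|S|.+1.
Proof.
move=> /force_stepP[v [w [_ gv ->]]]; rewrite cardsU1.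
by have /setP/(_ w) := gv; rewrite !inE eqxx => /andP[-> _].
Qed.

(* The vertices that have forced so far have no white neighbour left. *)
Lemma forcing_vertices g S S' : connect (force_step g) S S' ->
  exists U : {set 'I_n}, [/\ U \subset S', #|U| + #|S| = #|S'|
    & forall u, u \in U -> g u \subset S'].
Proof.
move: S'; apply: connect_rcons_ind => [|S1 S2 _ [U [US1 cardU gU]] st].
  by exists set0; split; [rewrite sub0set|rewrite cards0|move=> u; rewrite inE].
have cardS2 := card_force_step st.
have [v [w [vS1 gv S2E]]] := force_stepP st.
have S12 : S1 \subset S2 by rewrite S2E subsetUr.
(* The neighbour w of v is still white, so v has not forced before. *)
have vU : v \notin U.
  apply/negP=> /gU; rewrite -setD_eq0 gv => /eqP/setP/(_ w).
  by rewrite !inE eqxx.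
exists (v |: U); split.
- by rewrite subUset sub1set (subsetP S12) // (subset_trans US1).
- by rewrite cardsU1 vU cardS2 -cardU.
move=> u; rewrite inE => /orP[|uU]; last exact: subset_trans (gU u uU) S12.
rewrite inE => /eqP->; apply/subsetP=> z zv; rewrite S2E in_setU1.
have [//|zS1] := boolP (z \in S1); first by rewrite orbT.
have : z \in g v :\: S1 by rewrite inE zS1.
by rewrite gv inE => ->.
Qed.

(** Each step blackens exactly one vertex, so no size is skipped. *)
Lemma intermediate_forcing g S S' k : connect (force_step g) S S' ->
  #|S| <= k <= #|S'| -> exists2 S1, connect (force_step g) S S1 & #|S1| = k.
Proof.
move: S'; apply: connect_rcons_ind => [|S1 S2 con IH st] /andP[Sk kS].
  by exists S; [exact: connect0|apply/eqP; rewrite eqn_leq Sk kS].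
move: kS; rewrite leq_eqVlt => /orP[/eqP ->|].
  by exists S2 => //; apply: connect_trans con (connect1 st).
by rewrite (card_force_step st) ltnS => kS1; apply: IH; rewrite Sk.
Qed.

Lemma subset_of_card (T : finType) (A : {set T}) k : k <= #|A| ->
  exists2 B : {set T}, B \subset A & #|B| = k.
Proof.
move=> kA; have /card_gt0P[B] : 0 < #|[set B : {set T} | B \subset A & #|B| == k]|.
  by rewrite cards_draws bin_gt0.
by rewrite inE => /andP[BA /eqP]; exists B.
Qed.

(** Stop when s white vertices are left. By then n - s - #|S| >= s distinct vertices have forced,
    and none of them has a white neighbour. *)
Lemma zero_forcing_hole g S s : zero_forcing_set g S -> #|S| + 2 * s <= n ->
  exists A B, [/\ #|A| = s, #|B| = s & hole g A B].
Proof.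
move=> zS Ss; have [] := @intermediate_forcing g S setT (n - s) zS.
  by rewrite cardsT card_ord leq_subr andbT; lia.
move=> S1 con cardS1; have [U [US1 cardU gU]] := forcing_vertices con.
have [|A AU cardA] := @subset_of_card _ U s; first by lia.
exists A, (~: S1); split=> //.
  by have := cardsC S1; rewrite card_ord; lia.
apply/andP; split; first by rewrite disjoints_subset setCK (subset_trans AU).
apply/forallP=> a; apply/implyP=> aA; rewrite setI_eq0 disjoints_subset setCK gU //.
exact: subsetP AU a aA.
Qed.

Lemma zero_forcing_number_no_hole g s : 2 * s <= n.+1 ->
  ~~ [exists A : {set 'I_n}, exists B : {set 'I_n}, [&& #|A| == s, #|B| == s & hole g A B]] ->
  n.+1 - 2 * s <= zero_forcing_number g.
Proof.
move=> sn /existsPn noh.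
(* Two empty sets form a hole, so s is positive and n+1-2s does not exceed n. *)
have [s0|s0] := posnP s.
  by case/existsP: (noh set0); exists set0; rewrite !cards0 s0 /hole disjoints_subset sub0set eqxx;
     apply/forallP=> a; rewrite inE.
apply: zero_forcing_number_ge => [|S zS]; first by lia.
rewrite leqNgt; apply/negP=> lt.
have [|A [B [cardA cardB hAB]]] := zero_forcing_hole (s := s) zS; first by lia.
by case/existsP: (noh A); exists B; rewrite cardA cardB !eqxx.
Qed.

(** Start with exactly W white. Each u is black and sees only its own w in W, so the vertices of W
    can be forced in any order. *)
Lemma zero_forcing_private g W :
  (forall w, w \in W -> exists2 u, u \notin W & g u :&: W = [set w]) ->
  zero_forcing_number g <= n - #|W|.
Proof.
move=> priv; have <- : #|~: W| = n - #|W| by have := cardsC W; rewrite card_ord; lia.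
apply: zero_forcing_number_le; rewrite /zero_forcing_set.
(* W1 is the set still white; the forcing vertices given by [priv] keep working as it shrinks. *)
suff: forall k W1, #|W1| = k -> W1 \subset W -> connect (force_step g) (~: W1) setT.
  by apply.
elim=> [|k IH] W1 cardW1 W1W.
  by rewrite (cards0_eq cardW1) setC0 connect0.
have /card_gt0P[w wW1] : 0 < #|W1| by rewrite cardW1.
have [u uW gu] := priv w (subsetP W1W w wW1).
apply: (connect_trans (y := w |: ~: W1)).
  apply/connect1/existsP; exists u; rewrite inE (contra (subsetP W1W u)) //=.
  apply/existsP; exists w; rewrite eqxx andbT setDE setCK; apply/eqP/setP=> z.
  move/setP: gu => /(_ z); rewrite !inE.
  have [->|_] := eqVneq z w; first by rewrite wW1 => /andP[->].
  by move/negbT; rewrite negb_and => /orP[/negbTE->//|zW]; rewrite (contraNF (subsetP W1W z)) ?andbF.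
have -> : w |: ~: W1 = ~: (W1 :\ w) by rewrite setCD setUC.
apply: IH; last exact: subset_trans (subsetDl _ _) W1W.
by move: (cardsD1 w W1); rewrite wW1 cardW1 => -[].
Qed.

End ZeroForcing.

(** * Random colourings *)

(** Substitution turns the first inequality into 2 a^2 N <= a^2 p + a b N + a^2 N; cancel a^2 N and
    divide by a. *)
Lemma chebyshev_arith (a b p N x y : nat) : 0 < a ->
  2 * (a * b) * x <= a ^ 2 * p + b ^ 2 * (x + y) ->
  b * x = a * N -> b ^ 2 * y = a ^ 2 * N -> a * N <= a * p + b * N.
Proof.
move=> a_gt0 main bx by_; rewrite -(leq_pmul2l a_gt0).
move: main; rewrite mulnDr by_ -!mulnn -!mulnA bx mulnDr (mulnCA b).
by move: (a * (a * N)) (a * (a * p)) (a * (b * N)) => A B C; lia.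
Qed.

Section RandomColouring.
Variables (n d m : nat) (g : graph n).
Hypotheses (reg : regular_graph d g) (nd : 2 * d < n).
Local Notation colouring := {ffun 'I_n -> 'I_m.+1}.
Implicit Types (u v w : 'I_n) (T : {set 'I_n}) (c : colouring).

Definition avoids c T := [forall w in T, c w != ord0].
(** Including u itself ensures that a u whose block avoids colour 0 starts black; v is left out
    because it has colour 0. *)
Definition block v u := u |: (g u :\ v).
Definition private_vertices c :=
  [set v | (c v == ord0) && [exists u in g v, avoids c (block v u)]].

Lemma private_vertices_private c v : v \in private_vertices c ->
  exists2 u, u \notin private_vertices c & g u :&: private_vertices c = [set v].
Proof.
have /regular_graphP[_ sym _] := reg.
move=> vP; move: (vP); rewrite inE => /andP[_ /existsP[u /andP[uv /forall_inP av]]].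
exists u; first by rewrite inE negb_and (av u) // /block !inE eqxx.
apply/setP=> z; rewrite !inE; have [->|zv] := eqVneq z v.
  by rewrite sym uv; move: vP; rewrite inE.
have [zu|//] /= := boolP (z \in g u).
by rewrite (negbTE (av z _)) // /block !inE zv zu orbT.
Qed.

Lemma card_block v u : u \in g v -> #|block v u| = d.
Proof.
have /regular_graphP[irr sym deg] := reg.
move=> uv; rewrite /block cardsU1 !inE (negbTE (irr u)) andbF -[RHS](deg u).
by rewrite [RHS](cardsD1 v) sym uv.
Qed.

(** A common vertex would close a triangle or a 4-cycle through v. Disjointness makes the avoidance
    events of two blocks independent. *)
Lemma disjoint_block v u u' : ~~ on_short_cycle g v -> u \in g v -> u' \in g v ->
  u != u' -> [disjoint block v u & block v u'].
Proof.
move=> good uv u'v uu'; rewrite -setI_eq0; apply: contraNT good => /set0Pn[w].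
have /regular_graphP[irr _ _] := reg.
rewrite !inE => /andP[wu wu'].
have wv : w != v.
  move: wu => /orP[/eqP->|/andP[//]].
  by apply: contraTneq uv => ->.
apply/existsP; exists u; rewrite uv /=; apply/existsP; exists u'; rewrite u'v /=.
apply/existsP; exists w; rewrite uu' wv !inE.
by move: wu wu'; rewrite wv /= => -> ->.
Qed.

Lemma notin_block v u : u \in g v -> v \notin block v u.
Proof.
have /regular_graphP[irr _ _] := reg.
by move=> uv; rewrite !inE eqxx orbF; apply: contraTneq uv => <-.
Qed.

(** These colourings form a product: one choice at v, m on T, and m+1 at each of the remaining
    vertices. *)
Lemma card_avoids v T : v \notin T ->
  #|[set c : colouring | (c v == ord0) && avoids c T]| = m ^ #|T| * m.+1 ^ (n.-1 - #|T|).
Proof.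
move=> vT.
pose F w : pred 'I_m.+1 :=
  if w == v then pred1 ord0 else if w \in T then predC1 ord0 else predT.
rewrite cardsE (eq_card (B := family F)); last first.
  move=> c; rewrite [LHS]unfold_in; apply/andP/familyP => [[/eqP cv /forall_inP av] w|fam].
    rewrite /F; have [->|_] := eqVneq; first by rewrite inE cv.
    by case: ifP => // wT; rewrite inE av.
  split; first by have := fam v; rewrite /F eqxx inE.
  apply/forall_inP=> w wT; have := fam w; rewrite /F wT.
  by case: eqVneq => [wv|_]; rewrite ?inE //; rewrite -wv wT in vT.
rewrite card_family foldrE big_map big_enum /=.
rewrite (bigD1 v) //= {1}/F eqxx card1 mul1n (bigID (mem T)) /=; congr (_ * _).
  rewrite -prod_nat_const; apply: eq_big => [w|w /andP[wv wT]].
    by rewrite andb_idl // => wT; apply: contraNneq vT => <-.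
  by rewrite /F (negbTE wv) wT cardC1 card_ord.
rewrite (eq_bigr (fun=> m.+1)); last first.
  by move=> w /andP[/negbTE wv /negbTE wT]; rewrite /F wv wT card_ord.
rewrite prod_nat_const; congr (_ ^ _).
rewrite (eq_card (B := ~: (v |: T))); last by move=> w; rewrite !inE negb_or.
by have := cardsC (v |: T); rewrite cardsU1 vT card_ord add1n => cardT; rewrite -[X in _ = X.-1 - _]cardT addSn addKn.
Qed.

(** Given that v has colour 0, a block of d vertices is avoided with probability m^d / b. N0 counts
    the colourings giving v colour 0. *)
Let a := d * m ^ d.
Let b := m.+1 ^ d.
Let N0 := m.+1 ^ n.-1.

(* Chebyshev's inequality for X = #{u in N(v) : block v u is avoided}, of mean a / b. *)
Lemma card_private_colourings v : ~~ on_short_cycle g v ->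
  a * N0 <= a * #|[set c : colouring | v \in private_vertices c]| + b * N0.
Proof.
move=> good; have /regular_graphP[_ _ deg] := reg.
pose X c := \sum_(u in g v) avoids c (block v u).
(* If v is private this is (a - bX)^2 >= 0; otherwise X = 0. *)
have pointwise c : c v == ord0 ->
    2 * (a * b) * X c <= a ^ 2 * (v \in private_vertices c) + b ^ 2 * X c ^ 2.
  move=> cv; rewrite inE cv /=; case: existsP => [_|none].
    rewrite muln1 -expnMn; have := (nat_Cauchy a (b * X c)).1.
    by rewrite !mulnA.
  rewrite [X c]big1 ?muln0 // => u uv; apply/eqP; rewrite eqb0.
  by apply/negP=> av; apply: none; exists u; rewrite uv.
have avoid_sum u u' : \sum_(c : colouring | c v == ord0) (avoids c (block v u) * avoids c (block v u')) =
    #|[set c : colouring | (c v == ord0) && avoids c (block v u :|: block v u')]|.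
  rewrite -sum1dep_card [RHS]big_mkcondr /=; apply: eq_bigr => c _.
  have -> : avoids c (block v u :|: block v u') = avoids c (block v u) && avoids c (block v u').
    apply/forall_inP/andP => [av|[/forall_inP av /forall_inP av'] w].
      by split; apply/forall_inP=> w wu; apply: av; rewrite inE wu ?orbT.
    by rewrite inE => /orP[/av|/av'].
  by rewrite mulnb; case: (_ && _).
pose N1 := m ^ d * m.+1 ^ (n.-1 - d).
pose N2 := m ^ (2 * d) * m.+1 ^ (n.-1 - 2 * d).
have avoid1 u : u \in g v -> \sum_(c : colouring | c v == ord0) (avoids c (block v u) * avoids c (block v u)) = N1.
  by move=> uv; rewrite avoid_sum setUid card_avoids ?card_block // notin_block.
have avoid2 u u' : u \in g v -> u' \in g v -> u != u' ->
    \sum_(c : colouring | c v == ord0) (avoids c (block v u) * avoids c (block v u')) = N2.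
  move=> uv u'v uu'; rewrite avoid_sum card_avoids; last by rewrite inE negb_or !notin_block.
  have dis := disjoint_block good uv u'v uu'.
  have cardU : #|block v u :|: block v u'| = 2 * d.
    by rewrite cardsU disjoint_setI0 // cards0 subn0 !card_block // addnn mul2n.
  by rewrite cardU.
have sumX : \sum_(c : colouring | c v == ord0) X c = d * N1.
  rewrite exchange_big /= -(deg v) -sum_nat_const; apply: eq_bigr => u uv.
  by rewrite -(avoid1 u uv); apply: eq_bigr => c _; rewrite mulnb andbb.
(* The d diagonal terms give N1 each; the d(d-1) others give N2 each and are rounded up to d^2. *)
have sumX2 : \sum_(c : colouring | c v == ord0) X c ^ 2 <= d * N1 + d ^ 2 * N2.
  have -> : \sum_(c : colouring | c v == ord0) X c ^ 2 =
     \sum_(u in g v) \sum_(u' in g v) \sum_(c : colouring | c v == ord0) (avoids c (block v u) * avoids c (block v u')).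
    rewrite (eq_bigr (fun c => \sum_(u in g v) \sum_(u' in g v) (avoids c (block v u) * avoids c (block v u')))).
      by rewrite exchange_big; apply: eq_bigr => u _; rewrite exchange_big.
    move=> c _; rewrite -mulnn {1}/X big_distrl; apply: eq_bigr => u _.
    by rewrite /X big_distrr.
  have -> : d * N1 + d ^ 2 * N2 = \sum_(u in g v) (N1 + d * N2).
    by rewrite sum_nat_const deg; nia.
  apply: leq_sum => u uv; rewrite (bigD1 u) //= avoid1 // leq_add2l.
  have -> : d * N2 = \sum_(u' in g v) N2 by rewrite sum_nat_const deg.
  rewrite [leqRHS](bigD1 u) //=; apply: leq_trans (leq_addl _ _).
  by apply: leq_sum => u' /andP[u'v u'u]; rewrite avoid2 // eq_sym.
have cardP : #|[set c : colouring | v \in private_vertices c]| = \sum_(c : colouring | c v == ord0) (v \in private_vertices c).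
  rewrite -sum1dep_card big_mkcond [RHS]big_mkcond /=; apply: eq_bigr => c _.
  by rewrite inE; case: (c v == ord0) => //=; case: existsP.
have main : 2 * (a * b) * (d * N1) <= a ^ 2 * #|[set c : colouring | v \in private_vertices c]| + b ^ 2 * (d * N1 + d ^ 2 * N2).
  rewrite cardP -{1}sumX; apply: (@leq_trans (a ^ 2 * \sum_(c : colouring | c v == ord0) (v \in private_vertices c) + b ^ 2 * \sum_(c : colouring | c v == ord0) X c ^ 2)).
    by rewrite !big_distrr -big_split; apply: leq_sum => c /pointwise.
  by rewrite leq_add2l leq_mul.
have bN1 : b * (d * N1) = a * N0.
  rewrite /b /a /N0 /N1 mulnCA -[in RHS]mulnA; congr (_ * _).
  by rewrite mulnCA -expnD subnKC //; lia.
have bN2 : b ^ 2 * (d ^ 2 * N2) = a ^ 2 * N0.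
  rewrite /b /a /N0 /N2 expnMn -!expnM [d * 2]mulnC mulnCA -[in RHS]mulnA; congr (_ * _).
  by rewrite mulnCA -expnD subnKC //; lia.
have [a0|a_gt0] := posnP a; first by rewrite a0.
exact: chebyshev_arith main bN1 bN2.
Qed.

(** Count the pairs of a colouring and a private vertex. Each good vertex is private in at least (1
    - b/a) N0 colourings, while each of the (m+1) N0 colourings has at most n - Z(g) private
    vertices. *)
Lemma zero_forcing_colouring :
  (n - #|[set v | on_short_cycle g v]|) * (a - b) <= a * m.+1 * (n - zero_forcing_number g).
Proof.
set bad := [set v | _].
have N0_gt0 : 0 < N0 by rewrite expn_gt0.
have lower : (n - #|bad|) * ((a - b) * N0) <= \sum_v a * #|[set c : colouring | v \in private_vertices c]|.
  have <- : #|~: bad| = n - #|bad| by have := cardsC bad; rewrite card_ord; lia.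
  rewrite -sum_nat_const [leqRHS](bigID (mem (~: bad))) /=.
  apply: leq_trans (leq_addr _ _); apply: leq_sum => v; rewrite !inE => vgood.
  by rewrite mulnBl leq_subLR addnC card_private_colourings.
have double : \sum_v #|[set c : colouring | v \in private_vertices c]| = \sum_(c : colouring) #|private_vertices c|.
  rewrite (eq_bigr (fun v => \sum_(c : colouring) (v \in private_vertices c))).
    by rewrite exchange_big; apply: eq_bigr => c _; apply: (sum_nat_pred (mem (private_vertices c))).
  move=> v _; rewrite -sum1dep_card big_mkcond; apply: eq_bigr => c _; by case: (_ \in _).
have upper : \sum_(c : colouring) #|private_vertices c| <= m.+1 * N0 * (n - zero_forcing_number g).
  have -> : m.+1 * N0 = #|{: {ffun 'I_n -> 'I_m.+1}}|.
    by rewrite card_ffun !card_ord -expnS prednK //; lia.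
  rewrite -sum_nat_const; apply: leq_sum => c _.
  have zk := zero_forcing_private (g := g) (W := private_vertices c) (@private_vertices_private c).
  have kn : #|private_vertices c| <= n by rewrite (leq_trans (max_card _)) ?card_ord.
  by rewrite leq_subCr // (leq_trans zk) // leq_subr.
rewrite -(leq_pmul2r N0_gt0) -mulnA (leq_trans lower) // -big_distrr /= double.
by apply: leq_trans (leq_mul (leqnn a) upper) _; rewrite -!mulnA (mulnC N0).
Qed.

End RandomColouring.

(** * Existence of regular graphs *)

Section Circulant.
Variables (n d : nat).
Hypotheses (dn : d + 2 <= n) (even_nd : ~~ odd (n * d)).

Let offset (x y : nat) := if y <= x then x - y else x + n - y.
(** Connection set of the circulant, closed under negation modulo n. For odd d, where n is even, the
    antipode n/2 supplies the last neighbour. *)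
Let jump k := [|| 0 < k <= d./2, n - d./2 <= k < n | odd d && (k == n./2)].

Definition circulant : graph n := [ffun x : 'I_n => [set y : 'I_n | jump (offset x y)]].

Lemma count_jump : count jump (iota 0 n) = d.
Proof.
have dE := odd_double_half d; have nE := odd_double_half n.
have oddn : odd d -> ~~ odd n by move=> od; move: even_nd; rewrite oddM od andbT.
(* Cut the residues into 0, the short positive jumps, the middle range and the short negative
   jumps. *)
have -> : n = 1 + (d./2 + ((n - 2 * d./2 - 1) + d./2)) by lia.
rewrite !iotaD !count_cat.
have c1 : count jump (iota 0 1) = 0.
  by rewrite /= /jump; case: (odd d) dE => /=; lia.
have c2 : count jump (iota 1 d./2) = d./2.
  rewrite -[RHS](size_iota 1); apply/eqP; rewrite -all_count; apply/allP=> k.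
  by rewrite mem_iota /jump; lia.
have c4 : count jump (iota (1 + (d./2 + (n - 2 * d./2 - 1))) d./2) = d./2.
  rewrite -[RHS](size_iota (1 + (d./2 + (n - 2 * d./2 - 1)))); apply/eqP; rewrite -all_count; apply/allP=> k.
  by rewrite mem_iota /jump; lia.
have c3 : count jump (iota (1 + d./2) (n - 2 * d./2 - 1)) = odd d.
  rewrite (eq_in_count (a2 := fun k => odd d && (k == n./2))); last first.
    move=> k; rewrite mem_iota /jump => kI.
    have -> : 0 < k <= d./2 = false by lia.
    by have -> : n - d./2 <= k < n = false by lia.
  have [od|_] := boolP (odd d); last by rewrite (eq_count (a2 := pred0)) ?count_pred0.
  rewrite (eq_count (a2 := pred1 n./2)) // count_uniq_mem ?iota_uniq // mem_iota.
  by have := oddn od; lia.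
by rewrite c1 c2 !addnA in c4 *; rewrite c4 c3; lia.
Qed.

(** This makes the denominator of [prob_Gnd] positive. For the degree, y -> x - y modulo n is an
    involution taking the neighbours of x to the jumps. *)
Lemma circulant_regular : regular_graph d circulant.
Proof.
have oddn : odd d -> ~~ odd n by move=> od; move: even_nd; rewrite oddM od andbT.
apply/regular_graphP; split.
- move=> x; rewrite ffunE inE /offset leqnn subnn /jump /=.
  by case: (boolP (odd d)) => [/oddn|]; lia.
- move=> x y; rewrite !ffunE !inE /offset /jump; have := ltn_ord x; have := ltn_ord y.
  move: (nat_of_ord x) (nat_of_ord y) => p q qn pn.
  have nE := odd_double_half n; have dE := odd_double_half d.
  case: (boolP (odd d)) => [/oddn/negbTE nodd|_] /=; first rewrite nodd in nE.
    by case: (ltngtP p q) => [lt|lt|-> //]; apply/idP/idP => /orP[|/orP[|/eqP]] H; lia.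
  by rewrite !orbF; case: (ltngtP p q) => [lt|lt|-> //]; lia.
move=> x; rewrite ffunE.
have f_lt (y : 'I_n) : offset x y < n.
  rewrite /offset; have := ltn_ord x; have := ltn_ord y.
  by move: (nat_of_ord x) (nat_of_ord y) => p q qn pn; case: (leqP q p); lia.
pose f y := Ordinal (f_lt y).
have f_inv : involutive f.
  move=> y; apply: val_inj; rewrite /= /offset; have := ltn_ord x; have := ltn_ord y.
  by move: (nat_of_ord x) (nat_of_ord y) => p q qn pn; case: (leqP q p) => le_qp; case: leqP; lia.
have -> : [set y : 'I_n | jump (offset x y)] = f @^-1: [set k : 'I_n | jump k].
  by apply/setP=> y; rewrite !inE.
rewrite (card_preimset _ (inv_inj f_inv)) -[RHS]count_jump -val_enum_ord count_map.
by rewrite cardsE cardE {1}/enum_mem size_filter -enumT; apply: eq_count.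
Qed.

End Circulant.

(** * Asymptotic estimates *)

Section Estimates.
Local Open Scope R_scope.

Lemma INR_addn (a b : nat) : INR (a + b)%N = INR a + INR b.
Proof. by rewrite -plusE plus_INR. Qed.

Lemma INR_muln (a b : nat) : INR (a * b)%N = INR a * INR b.
Proof. by rewrite -multE mult_INR. Qed.

Lemma INR_expn (a k : nat) : INR (expn a k) = INR a ^ k.
Proof. by elim: k => [|k IH]; rewrite ?expn0 // expnS INR_muln IH. Qed.

Lemma INR_leq (a b : nat) : (a <= b)%N -> INR a <= INR b.
Proof. by move/leP; apply: le_INR. Qed.

Lemma INR_subn (a b : nat) : (b <= a)%N -> INR (a - b)%N = INR a - INR b.
Proof. by move=> ba; rewrite -{2}(subnK ba) INR_addn; lra. Qed.

Lemma leq_INR (a b : nat) : INR a <= INR b -> (a <= b)%N.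
Proof. by move=> h; apply/leP/INR_le. Qed.

Lemma exists_nat_floor (x : R) : 0 <= x -> exists k : nat, INR k <= x < INR k + 1.
Proof.
move=> x0; have [lo hi] := archimed x.
have : (0 <= up x - 1)%Z by apply: Zlt_succ_le; apply: lt_IZR; rewrite succ_IZR minus_IZR; lra.
move=> up0; exists (Z.to_nat (up x - 1)).
by rewrite INR_IZR_INZ Z2Nat.id // minus_IZR; lra.
Qed.

Lemma exp_pow (x : R) (k : nat) : exp x ^ k = exp (INR k * x).
Proof.
elim: k => [|k IH]; first by rewrite Rmult_0_l exp_0.
by rewrite -tech_pow_Rmult IH S_INR Rmult_plus_distr_r Rmult_1_l Rplus_comm exp_plus.
Qed.

Lemma exp_ge1 (x : R) : 1 + x <= exp x.
Proof.
have [->|/exp_ineq1] := Req_dec x 0; first by rewrite exp_0; lra.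
lra.
Qed.

(** Induction by means of (1 - 1/k)^k <= 1/e. *)
Lemma factorial_upper (i : nat) : (0 < i)%N ->
  INR i`! * exp (INR i) <= exp 1 * INR i * INR i ^ i.
Proof.
case: i => // i _; elim: i => [|i IH]; first by rewrite /= ; lra.
have i0 : 0 < INR i.+1 by apply: lt_0_INR; apply/ltP.
have i1 : 0 < INR i.+2 by apply: lt_0_INR; apply/ltP.
have base : INR i.+1 <= INR i.+2 * exp (- / INR i.+2).
  have := exp_ge1 (- / INR i.+2) => /(Rmult_le_compat_l (INR i.+2) _ _ (Rlt_le _ _ i1)).
  have := S_INR i.+1; have : INR i.+2 * / INR i.+2 = 1 by apply: Rinv_r; apply: Rgt_not_eq.
  by move: (INR i.+2) (INR i.+1) => p q; lra.
have : INR i.+1 ^ i.+2 <= INR i.+2 ^ i.+2 * exp (- 1).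
  have -> : exp (- 1) = exp (- / INR i.+2) ^ i.+2 by rewrite exp_pow; congr exp; field; apply: Rgt_not_eq.
  rewrite -Rpow_mult_distr; apply: pow_incr; lra.
move=> step.
have expS : exp (INR i.+2) = exp (INR i.+1) * exp 1 by rewrite (S_INR i.+1) exp_plus.
rewrite factS INR_muln expS.
have e1 : exp 1 * exp (-1) = 1 by rewrite -exp_plus Rplus_opp_r exp_0.
have e0 := exp_pos 1.
apply: (Rle_trans _ (INR i.+2 * exp 1 * (exp 1 * INR i.+1 * INR i.+1 ^ i.+1))).
  have pos : 0 <= INR i.+2 * exp 1 by apply: Rmult_le_pos; lra.
  by have := Rmult_le_compat_l _ _ _ pos IH; lra.
have -> : INR i.+2 * exp 1 * (exp 1 * INR i.+1 * INR i.+1 ^ i.+1)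
  = INR i.+2 * exp 1 * exp 1 * INR i.+1 ^ i.+2 by rewrite -(tech_pow_Rmult _ i.+1); ring.
have -> : exp 1 * INR i.+2 * INR i.+2 ^ i.+2
  = INR i.+2 * exp 1 * exp 1 * (INR i.+2 ^ i.+2 * exp (-1)).
  transitivity (INR i.+2 * exp 1 * INR i.+2 ^ i.+2 * (exp 1 * exp (-1))); last ring.
  by rewrite e1; ring.
apply: Rmult_le_compat_l => //; nra.
Qed.

(** Induction by means of (1 + 1/i)^i <= e. *)
Lemma factorial_lower (i : nat) : INR i ^ i <= INR i`! * exp (INR i).
Proof.
elim: i => [|i IH]; first by rewrite /= exp_0; lra.
rewrite factS INR_muln -tech_pow_Rmult S_INR exp_plus.
have i0 := pos_INR i; have e0 := exp_pos 1.
have step : (INR i + 1) ^ i <= INR i ^ i * exp 1.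
  case: i i0 {IH} => [|i] i0; first by rewrite /=; have := exp_ge1 1; lra.
  have ip : 0 < INR i.+1 by apply: lt_0_INR; apply/ltP.
  have -> : exp 1 = exp (/ INR i.+1) ^ i.+1 by rewrite exp_pow; congr exp; field; apply: Rgt_not_eq.
  rewrite -Rpow_mult_distr; apply: pow_incr; split; first lra.
  have := exp_ge1 (/ INR i.+1) => /(Rmult_le_compat_l _ _ _ i0).
  by rewrite Rmult_plus_distr_l Rmult_1_r Rinv_r; lra.
apply: (Rle_trans _ ((INR i + 1) * (INR i ^ i * exp 1))); first by apply: Rmult_le_compat_l; lra.
have pos : 0 <= (INR i + 1) * exp 1 by apply: Rmult_le_pos; lra.
by have := Rmult_le_compat_l _ _ _ pos IH; lra.
Qed.

Lemma ffact_leq_expn (n s : nat) : (n ^_ s <= expn n s)%N.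
Proof. by elim: s n => [|s IH] n //; rewrite ffactnSr expnSr leq_mul // leq_subr. Qed.

(** The binomial coefficient is at most n^s / s!, hence at most (e n / s)^s. *)
Lemma binomial_upper (n s d : nat) : exp 1 * INR n <= INR d * INR s ->
  INR 'C(n, s) <= INR d ^ s.
Proof.
move=> en; have f0 : 0 < INR s`! by apply: lt_0_INR; apply/ltP/fact_gt0.
apply: (Rmult_le_reg_r _ _ _ f0); rewrite -INR_muln bin_ffact.
apply: Rle_trans (INR_leq (ffact_leq_expn n s)) _; rewrite INR_expn.
apply: (Rmult_le_reg_r (exp (INR s))); first exact: exp_pos.
have -> : exp (INR s) = exp 1 ^ s by rewrite exp_pow Rmult_1_r.
rewrite -Rpow_mult_distr; apply: (Rle_trans _ ((INR d * INR s) ^ s)).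
  apply: pow_incr; rewrite Rmult_comm; split=> //.
  by apply: Rmult_le_pos; [apply: Rlt_le; apply: exp_pos|apply: pos_INR].
rewrite Rpow_mult_distr Rmult_assoc; apply: Rmult_le_compat_l; first exact/pow_le/pos_INR.
by rewrite exp_pow Rmult_1_r; apply: factorial_lower.
Qed.

(* The counts [b_j = j! c_j] grow by a factor [rho] per step, on average, up to
   [j = rho]; there [c_j] is at most the number of all regular graphs. *)
Lemma num_between0_upper (n d s : nat) (A B : {set 'I_n}) (rho : R) :
  [disjoint A & B] -> #|A| = s -> #|B| = s -> 2 <= rho ->
  INR n * INR d * rho + 2 * rho ^ 2 + 2 * rho * (INR s * INR d) + 3 * INR s * INR d ^ 3
    <= (INR s * INR d) ^ 2 ->
  INR (num_between d A B 0) <= INR (num_regular n d) * (exp 3 * rho * exp (- rho)).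
Proof.
move=> dAB cardA cardB rho2 rho_le.
pose c j := INR (num_between d A B j); pose b j := INR j`! * c j.
have c0 j : 0 <= c j by apply: pos_INR.
have cG j : c j <= INR (num_regular n d).
  by apply/INR_leq/subset_leq_card/subsetP=> g; rewrite !inE => /andP[].
have fp j : 0 < INR j`! by apply: lt_0_INR; apply/ltP/fact_gt0.
pose L := INR n * INR d * rho + 2 * rho ^ 2.
have N0 : 0 <= INR n * INR d by apply: Rmult_le_pos; apply: pos_INR.
have D0 : 0 <= INR s * INR d by apply: Rmult_le_pos; apply: pos_INR.
(* For j <= rho the hypothesis on rho absorbs the error terms of the recursion, and (j+2)^2 <= 2
   (j+1)(j+2). *)
have rec j : INR j <= rho -> L * b j <= INR n * INR d * b j.+1 + 2 * b j.+2.
  move=> jrho.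
  have := INR_leq (num_between_recursion d dAB cardA cardB j).
  rewrite !(INR_addn, INR_muln, INR_expn) -/(c j) -/(c j.+1) -/(c j.+2) /b.
  rewrite !factS !INR_muln !S_INR /= => main.
  have j0 := pos_INR j.
  have h1 : L * c j <= (INR s * INR d) ^ 2 * c j
      - (2 * INR j * (INR s * INR d) + 3 * INR s * INR d ^ 3) * c j.
    rewrite -Rmult_minus_distr_r; apply: Rmult_le_compat_r => //.
    by rewrite /L; have := Rmult_le_compat_r _ _ _ D0 jrho; lra.
  have h2 : (INR j + 1 + 1) * (INR j + 1 + 1) * c j.+2
      <= 2 * ((INR j + 1 + 1) * (INR j + 1)) * c j.+2.
    by apply: Rmult_le_compat_r => //; nra.
  have h3 : L * c j <= (INR j + 1) * (INR n * INR d) * c j.+1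
      + 2 * ((INR j + 1 + 1) * (INR j + 1)) * c j.+2.
    by rewrite /= in h1; lra.
  by have := Rmult_le_compat_l _ _ _ (Rlt_le _ _ (fp j)) h3; lra.
(* The recursion looks two steps ahead, so only one of two consecutive indices is sure to be good.
   If the next two both failed, [rec] would be violated, as L = nd rho + 2 rho^2. *)
have grow j : INR j <= rho -> rho ^ j * b 0%N <= b j \/ rho ^ j.+1 * b 0%N <= b j.+1.
  elim: j => [|j IH]; first by left; rewrite /=; lra.
  rewrite S_INR => jrho.
  have [|h|h] := IH; [lra| |by left].
  have [|h1] := Rle_lt_dec (rho ^ j.+1 * b 0%N) (b j.+1); first by left.
  have [|h2] := Rle_lt_dec (rho ^ j.+2 * b 0%N) (b j.+2); first by right.
  have := rec j ltac:(lra).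
  have L0 : 0 <= L by rewrite /L; nra.
  have := Rmult_le_compat_l _ _ _ L0 h.
  have := Rmult_le_compat_l _ _ _ N0 (Rlt_le _ _ h1).
  by rewrite /L -!tech_pow_Rmult in h1 h2 *; nra.
(* With k the floor of rho - 1, both k and k+1 lie in the interval from rho - 2 to rho. *)
have [k [klo khi]] := exists_nat_floor (x := rho - 1) ltac:(lra).
have [i [ilo [ihi growi]]] : exists i : nat, rho - 2 < INR i /\ INR i <= rho /\ rho ^ i * b 0%N <= b i.
  have [|h|h] := grow k; first lra.
    by exists k; split; [lra|split; [lra|]].
  by exists k.+1; rewrite S_INR; split; [lra|split; [lra|]].
have ip : (0 < i)%N by apply/ltP/INR_lt; rewrite /=; lra.
have b0E : b 0%N = c 0%N by rewrite /b fact0 /= Rmult_1_l.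
rewrite b0E /b in growi; have e0 := exp_pos (INR i).
have G0 : 0 <= INR (num_regular n d) by apply: pos_INR.
have rp : 0 < rho ^ i by apply: pow_lt; lra.
(* Combine rho^i c_0 <= i! c_i, the trivial bound on c_i, and i! e^i <= e i i^i <= e rho rho^i. *)
have key : c 0%N * exp (INR i) <= INR (num_regular n d) * (exp 1 * rho).
  apply: (Rmult_le_reg_l _ _ _ rp).
  apply: (Rle_trans _ (INR i`! * exp (INR i) * INR (num_regular n d))).
    have := Rmult_le_compat_r _ _ _ (Rlt_le _ _ e0) growi.
    have := Rmult_le_compat_l (INR i`! * exp (INR i)) _ _ ltac:(have := fp i; nra) (cG i).
    lra.
  have i0 := pos_INR i; have E := exp_pos 1.
  have pi : INR i ^ i <= rho ^ i by apply: pow_incr; lra.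
  have pi0 : 0 <= INR i ^ i by apply: pow_le.
  have := factorial_upper ip => /(Rmult_le_compat_r _ _ _ G0) fu.
  apply: Rle_trans fu _.
  have -> : rho ^ i * (INR (num_regular n d) * (exp 1 * rho)) = exp 1 * rho * rho ^ i * INR (num_regular n d) by ring.
  apply: Rmult_le_compat_r => //; apply: Rmult_le_compat => //; first nra.
  by apply: Rmult_le_compat_l; lra.
have ei : exp (INR i) * exp (- INR i) = 1 by rewrite -exp_plus Rplus_opp_r exp_0.
rewrite -/(c 0%N) -[c 0%N]Rmult_1_r -ei -Rmult_assoc.
apply: (Rle_trans _ (INR (num_regular n d) * (exp 1 * rho) * exp (- INR i))).
  by apply: Rmult_le_compat_r => //; apply: Rlt_le; apply: exp_pos.
rewrite Rmult_assoc; apply: Rmult_le_compat_l => //.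
(* Using i > rho - 2 in place of i = rho costs the factor e^2. *)
have -> : exp 3 * rho * exp (- rho) = exp 1 * rho * exp (2 - rho).
  have -> : 3 = 1 + 2 by lra.
  by rewrite exp_plus /Rminus exp_plus; ring.
apply: Rmult_le_compat_l; first by have := exp_pos 1; nra.
have [->|lt] := Req_dec (- INR i) (2 - rho); first lra.
by apply: Rlt_le; apply: exp_increasing; lra.
Qed.

End Estimates.

(** * First-moment bounds for holes and for short cycles *)

Definition has_hole n (s : nat) (g : graph n) :=
  [exists A : {set 'I_n}, exists B : {set 'I_n}, [&& #|A| == s, #|B| == s & hole g A B]].

(** Union bound over the pairs (A, B) of disjoint s-sets. *)
Lemma card_has_hole (n d s K : nat) :
  (forall A B : {set 'I_n}, [disjoint A & B] -> #|A| = s -> #|B| = s ->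
     num_between d A B 0 <= K) ->
  #|[set g : graph n | regular_graph d g && has_hole s g]| <= 'C(n, s) ^ 2 * K.
Proof.
move=> leK; pose D := ({set 'I_n} * {set 'I_n})%type.
pose ok (p : D) := [&& #|p.1| == s, #|p.2| == s & [disjoint p.1 & p.2]].
apply: (@leq_trans (\sum_(p | ok p) num_between d p.1 p.2 0)).
  rewrite -sum1dep_card; under [leqRHS]eq_bigr do rewrite /num_between -sum1dep_card big_mkcond.
  rewrite exchange_big big_mkcond /=; apply: leq_sum => g _.
  case: ifP => // /andP[reg /existsP[A /existsP[B /and3P[cA cB /andP[dAB /forall_inP noe]]]]].
  rewrite (bigD1 (A, B)) /ok /= ?cA ?cB // reg /edges_between big1 // => a aA.
  have /eqP/setP e := noe a aA; apply: big1 => b bB.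
  by have := e b; rewrite !inE bB andbT => ->.
have -> : 'C(n, s) ^ 2 * K = \sum_(p : D | (#|p.1| == s) && (#|p.2| == s)) K.
  rewrite sum_nat_const; congr (_ * _); rewrite -{1}[n]card_ord -card_draws -mulnn -cardsX.
  by apply: eq_card => -[A B]; rewrite !inE.
rewrite [leqRHS](bigID (fun p : D => [disjoint p.1 & p.2])) /=.
apply: leq_trans (leq_addr _ _).
have okE p : ok p = ((#|p.1| == s) && (#|p.2| == s)) && [disjoint p.1 & p.2] by rewrite /ok andbA.
rewrite (eq_bigl _ _ okE).
by apply: leq_sum => -[A B] /andP[/andP[/eqP cA /eqP cB] dAB]; apply: leK.
Qed.

Section Asymptotics.
Local Open Scope R_scope.

Lemma exp_quadratic (x : R) : 0 <= x -> x ^ 2 / 4 <= exp x.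
Proof.
move=> x0; have -> : x = x / 2 + x / 2 by lra.
rewrite exp_plus; have := exp_ge1 (x / 2); have := exp_pos (x / 2).
by move: (exp _) => e; nra.
Qed.

(** The pairs number at most d^(2s) <= exp ((1 - kappa) rho), and each is a hole in a fraction at
    most e^3 rho exp (- rho) of the graphs. With e^3 <= 27 and z^2 exp (- z) <= 4 at z = kappa rho,
    the product is at most 108 / (kappa^2 rho). *)
Lemma has_hole_upper (n d s : nat) (rho kappa : R) :
  2 <= rho -> 0 < kappa ->
  INR n * INR d * rho + 2 * rho ^ 2 + 2 * rho * (INR s * INR d) + 3 * INR s * INR d ^ 3
    <= (INR s * INR d) ^ 2 ->
  exp 1 * INR n <= INR d * INR s -> 0 < INR d ->
  2 * INR s * ln (INR d) <= (1 - kappa) * rho ->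
  INR #|[set g : graph n | regular_graph d g && has_hole s g]| * (kappa ^ 2 * rho)
    <= 108 * INR (num_regular n d).
Proof.
move=> rho2 kappa0 rho_le en d0 srho; set G := INR (num_regular n d).
have G0 : 0 <= G by apply: pos_INR.
have [|K [Klo Khi]] := exists_nat_floor (x := G * (exp 3 * rho * exp (- rho))).
  apply: Rmult_le_pos => //; apply: Rmult_le_pos; last exact/Rlt_le/exp_pos.
  by apply: Rmult_le_pos; [apply/Rlt_le/exp_pos|lra].
have := @card_has_hole n d s K _ => /(_ _)/INR_leq-/(_ _) holeK.
have {holeK} : INR #|[set g : graph n | regular_graph d g && has_hole s g]| <= INR 'C(n, s) ^ 2 * INR K.
  rewrite -INR_expn -INR_muln; apply: holeK => A B dAB cA cB; rewrite -ltnS.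
  apply/ltP/INR_lt; rewrite S_INR; apply: Rle_lt_trans Khi.
  exact: num_between0_upper dAB cA cB rho2 rho_le.
move=> holeK.
have C2 : INR 'C(n, s) ^ 2 <= exp (2 * INR s * ln (INR d)).
  have -> : exp (2 * INR s * ln (INR d)) = (INR d ^ s) ^ 2.
    by rewrite -{2}(exp_ln _ d0) !exp_pow; congr exp; rewrite /=; ring.
  by apply: pow_incr; split; [apply: pos_INR|apply: binomial_upper].
have e3 : exp 3 <= 27.
  have -> : 3 = INR 3 * 1 by rewrite /=; ring.
  rewrite -exp_pow; apply: (Rle_trans _ (3 ^ 3)); last by rewrite /=; lra.
  by apply: pow_incr; split; [apply/Rlt_le/exp_pos|apply: exp_le_3].
have expE : exp (2 * INR s * ln (INR d)) * exp (- rho) <= exp (- (kappa * rho)).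
  rewrite -exp_plus; have [->|ne] := Req_dec (2 * INR s * ln (INR d) + - rho) (- (kappa * rho)); first lra.
  by apply: Rlt_le; apply: exp_increasing; lra.
have small : exp (- (kappa * rho)) * (kappa * rho) ^ 2 <= 4.
  have kr : 0 <= kappa * rho by apply: Rmult_le_pos; lra.
  have := exp_quadratic kr => /(Rmult_le_compat_l _ _ _ (Rlt_le _ _ (exp_pos (- (kappa * rho))))).
  rewrite -exp_plus Rplus_opp_l exp_0; lra.
have kp : 0 <= kappa ^ 2 * rho by nra.
have e3p := exp_pos 3; have erp := exp_pos (- rho).
have step : INR 'C(n, s) ^ 2 * INR K <= exp (- (kappa * rho)) * (G * (27 * rho)).
  have K0 := pos_INR K; have c20 : 0 <= INR 'C(n, s) ^ 2 by apply: pow_le; apply: pos_INR.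
  apply: (Rle_trans _ (exp (2 * INR s * ln (INR d)) * (G * (exp 3 * rho * exp (- rho))))).
    by apply: Rmult_le_compat.
  apply: (Rle_trans _ (exp (- (kappa * rho)) * (G * (exp 3 * rho)))).
    have q : 0 <= G * (exp 3 * rho) by apply: Rmult_le_pos => //; nra.
    by have := Rmult_le_compat_r _ _ _ q expE; lra.
  apply: Rmult_le_compat_l; first exact/Rlt_le/exp_pos.
  by apply: Rmult_le_compat_l => //; apply: Rmult_le_compat_r; lra.
apply: Rle_trans (Rmult_le_compat_r _ _ _ kp (Rle_trans _ _ _ holeK step)) _.
have -> : exp (- (kappa * rho)) * (G * (27 * rho)) * (kappa ^ 2 * rho)
  = 27 * G * (exp (- (kappa * rho)) * (kappa * rho) ^ 2) by ring.
have := Rmult_le_compat_l (27 * G) _ _ ltac:(lra) small; lra.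
Qed.

(** Markov's inequality. The bound on n gives nd - 4(d+1)d >= nd/2, whence the factor 2. *)
Lemma many_on_short_cycle_upper (n d : nat) (t : R) : 0 < t -> (0 < d)%N -> (8 * d.+1 <= n)%N ->
  INR #|[set g : graph n | regular_graph d g
          && ~~ Rleb (INR #|[set v | on_short_cycle g v]|) t]| * t
    <= INR (num_regular n d) * (2 * INR d ^ 3 * (INR d + 1)).
Proof.
move=> t0 d0 nd; set many := [set g | _].
pose bad (g : graph n) := #|[set v | on_short_cycle g v]|.
(* A count above t is at least k+1, which in turn exceeds t. *)
have [k [klo khi]] := exists_nat_floor (Rlt_le _ _ t0).
have markov : (#|many| * k.+1 <= \sum_(g : graph n | regular_graph d g) bad g)%N.
  rewrite -sum_nat_const [leqRHS](bigID (mem many)) /=; apply: leq_trans (leq_addr _ _).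
  rewrite (eq_bigl (fun g : graph n => regular_graph d g && (g \in many))); last first.
    by move=> g; rewrite inE; case: (regular_graph d g).
  apply: leq_sum => g /andP[_]; rewrite inE => /andP[_].
  rewrite /Rleb; case: Rle_dec => // /Rnot_le_lt tb _.
  by apply/ltP/INR_lt; rewrite -/(bad g) in tb; lra.
have sumb : (n * d * \sum_(g : graph n | regular_graph d g) bad g
    <= 2 * (num_regular n d * (n * d ^ 4 * d.+1)))%N.
  apply: leq_trans (leq_mul (leqnn 2) (sum_on_short_cycle n d)).
  rewrite mulnA leq_mul2r; apply/orP; right.
  by rewrite mulnBr leq_subRL; nia.
have nd0 : 0 < INR n * INR d.
  by apply: Rmult_lt_0_compat; apply: lt_0_INR; apply/ltP => //; lia.
apply: (Rmult_le_reg_l _ _ _ nd0).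
have := INR_leq sumb; have := INR_leq markov.
rewrite !(INR_expn, INR_muln) !S_INR /=.
move: (INR (\sum_(_ | _) _)) => S mS S_le.
apply: (Rle_trans _ (INR n * INR d * S)); last by lra.
apply: Rmult_le_compat_l; first lra.
by apply: Rle_trans mS; apply: Rmult_le_compat_l; [apply: pos_INR|lra].
Qed.

End Asymptotics.

(** * The bounds for a single graph and the choice of constants *)

Section Main.
Local Open Scope R_scope.

Lemma RlebP (x y : R) : reflect (x <= y) (Rleb x y).
Proof. by rewrite /Rleb; case: Rle_dec => h; constructor. Qed.

Lemma zero_forcing_number_leq_order n (g : graph n) : (zero_forcing_number g <= n)%N.
Proof.
have := @zero_forcing_number_le n g setT (connect0 _ _).
by rewrite cardsT card_ord.
Qed.

(** With M = m+1 colours, [zero_forcing_colouring] loses one factor 1 - delta to the vertices on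
    short cycles and another to b <= delta a. What remains is n - Z >= (1 - delta)^2 n / M, with M
    <= 2d / ln d. *)
Lemma zero_forcing_upper (n d : nat) (g : graph n) (delta : R) :
  regular_graph d g -> (2 * d < n)%N -> 0 < delta <= 1 ->
  4 / delta <= ln (INR d) -> 3 * ln (INR d) <= INR d ->
  INR #|[set v | on_short_cycle g v]| <= delta * INR n ->
  INR (zero_forcing_number g)
    <= INR n * (1 - (1 - delta) ^ 2 * (ln (INR d) / (2 * INR d))).
Proof.
move=> reg dn delta01 l_ge l_le bad_le; set l := ln (INR d) in l_ge l_le *.
have l4 : 4 <= l.
  by apply: Rle_trans l_ge; apply: (Rmult_le_reg_r delta); [lra|rewrite /Rdiv Rmult_assoc Rinv_l; lra].
have d0 : 0 < INR d by lra.
have expl : exp l = INR d by apply: exp_ln.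
have q6 : 6 <= 2 * INR d / l.
  by apply: (Rmult_le_reg_r l); [lra|rewrite /Rdiv Rmult_assoc Rinv_l; lra].
have [[|m] [Mlo Mhi]] := exists_nat_floor (x := 2 * INR d / l) ltac:(lra); first by rewrite /= in Mhi; lra.
have M_le : INR m.+1 * l <= 2 * INR d.
  have := Rmult_le_compat_r l _ _ ltac:(lra) Mlo.
  by rewrite /Rdiv Rmult_assoc Rinv_l; lra.
(* From 2d < (m+2) l and m > 4, which gives m+2 <= 3m/2. *)
have m_ge : INR d <= 3 * l / 4 * INR m.
  have := Rmult_lt_compat_r l _ _ ltac:(lra) Mhi.
  by rewrite /Rdiv Rmult_assoc Rinv_l ?S_INR; lra.
have m0 : 0 < INR m by rewrite S_INR in Mhi; lra.
have main := INR_leq (zero_forcing_colouring m reg dn).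
pose a := INR (d * expn m d); pose b := INR (expn m.+1 d).
have aE : a = INR d * INR m ^ d by rewrite /a INR_muln INR_expn.
have a0 : 0 < a by rewrite aE; apply: Rmult_lt_0_compat => //; apply: pow_lt.
(* The ratio b/a is (1 + 1/m)^d / d <= exp (3l/4) / d = d^(-1/4), and d^(1/4) >= l/4 >= 1/delta. *)
have ba : b <= delta * a.
  have b_le : b <= INR m ^ d * exp (3 * l / 4).
    apply: (Rle_trans _ (INR m ^ d * exp (/ INR m) ^ d)).
      rewrite /b INR_expn -Rpow_mult_distr; apply: pow_incr; split; first exact: pos_INR.
      rewrite S_INR; have := exp_ge1 (/ INR m) => /(Rmult_le_compat_l _ _ _ (Rlt_le _ _ m0)).
      by rewrite Rmult_plus_distr_l Rmult_1_r Rinv_r; lra.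
    apply: Rmult_le_compat_l; first by apply/Rlt_le/pow_lt.
    rewrite exp_pow; have [->|ne] := Req_dec (INR d * / INR m) (3 * l / 4); first lra.
    apply/Rlt_le/exp_increasing; suff : INR d * / INR m <= 3 * l / 4 by lra.
    by apply: (Rmult_le_reg_r _ _ _ m0); rewrite Rmult_assoc Rinv_l; lra.
  have e4 : exp (3 * l / 4) <= delta * INR d.
    have l_div : 1 <= delta * (l / 4).
      have := Rmult_le_compat_l delta _ _ ltac:(lra) l_ge.
      have -> : delta * (4 / delta) = 4 by field; lra.
      lra.
    have -> : INR d = exp (3 * l / 4) * exp (l / 4) by rewrite -exp_plus -expl; congr exp; lra.
    have q_ge := exp_ge1 (l / 4); have p0 := exp_pos (3 * l / 4).
    have q1 : 1 <= delta * exp (l / 4).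
      by apply: Rle_trans l_div _; apply: Rmult_le_compat_l; lra.
    by have := Rmult_le_compat_l _ _ _ (Rlt_le _ _ p0) q1; lra.
  have mp : 0 < INR m ^ d by apply: pow_lt.
  rewrite aE; nra.
have badn : (#|[set v | on_short_cycle g v]| <= n)%N.
  by rewrite (leq_trans (max_card _)) ?card_ord.
move: main; rewrite !INR_muln INR_subn // [INR (_ - zero_forcing_number g)%N]INR_subn; last exact: zero_forcing_number_leq_order.
rewrite INR_subn; last by apply: leq_INR; rewrite -/a -/b; nra.
rewrite -INR_muln -/a -/b => main.
move: (INR (zero_forcing_number g)) (INR #|_|) (INR n) (pos_INR n) main bad_le => Z bd N N0 main bad_le.
have h1 : (1 - delta) * N * ((1 - delta) * a) <= a * INR m.+1 * (N - Z).
  apply: Rle_trans main; apply: Rmult_le_compat; try lra; nra.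
have h2 : (1 - delta) ^ 2 * N <= INR m.+1 * (N - Z).
  by apply: (Rmult_le_reg_l _ _ _ a0); rewrite /= in h1 *; lra.
have m1 : 0 < INR m.+1 by rewrite S_INR; lra.
have NZ : 0 <= N - Z.
  have : 0 <= INR m.+1 * (N - Z) by apply: Rle_trans h2; apply: Rmult_le_pos => //; apply: pow2_ge_0.
  by nra.
have h3 : (1 - delta) ^ 2 * N * l <= 2 * INR d * (N - Z).
  apply: (Rle_trans _ (INR m.+1 * (N - Z) * l)); first by apply: Rmult_le_compat_r; lra.
  by have := Rmult_le_compat_r _ _ _ NZ M_le; lra.
suff : (1 - delta) ^ 2 * (l / (2 * INR d)) * N <= N - Z by lra.
apply: (Rmult_le_reg_l (2 * INR d)); first lra.
have -> : 2 * INR d * ((1 - delta) ^ 2 * (l / (2 * INR d)) * N) = (1 - delta) ^ 2 * N * l by field; lra.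
exact: h3.
Qed.

Lemma zero_forcing_lower (n s : nat) (g : graph n) (y : R) :
  INR s <= y * INR n -> y <= 1 / 2 -> ~~ has_hole s g ->
  INR n * (1 - 2 * y) <= INR (zero_forcing_number g).
Proof.
move=> sy y2 noh; have n0 := pos_INR n.
have sn : (2 * s <= n.+1)%N.
  by apply: leq_INR; rewrite INR_muln (S_INR n) /=; nra.
have := INR_leq (zero_forcing_number_no_hole sn noh).
by rewrite INR_subn // INR_muln (S_INR n) /=; nra.
Qed.

(** Union bound: P fails only on Q1 or Q2, each of probability at most eta/2. *)
Lemma prob_Gnd_lower (n d : nat) (P Q1 Q2 : graph n -> bool) (eta : R) :
  (0 < num_regular n d)%N ->
  (forall g, regular_graph d g -> [|| P g, Q1 g | Q2 g]) ->
  INR #|[set g : graph n | regular_graph d g && Q1 g]| <= eta / 2 * INR (num_regular n d) ->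
  INR #|[set g : graph n | regular_graph d g && Q2 g]| <= eta / 2 * INR (num_regular n d) ->
  1 - eta <= prob_Gnd d P.
Proof.
move=> reg0 cover q1 q2.
have : (num_regular n d <= #|[set g : graph n | regular_graph d g && P g]| +
    (#|[set g : graph n | regular_graph d g && Q1 g]|
     + #|[set g : graph n | regular_graph d g && Q2 g]|))%N.
  apply: (@leq_trans #|[set g : graph n | regular_graph d g && P g]
      :|: ([set g : graph n | regular_graph d g && Q1 g]
     :|: [set g : graph n | regular_graph d g && Q2 g])|).
    apply/subset_leq_card/subsetP=> g; rewrite !inE => reg.
    by rewrite reg /= cover.
  apply: leq_trans (leq_card_setU _ _).1 _; rewrite leq_add2l.
  exact: (leq_card_setU _ _).1.
move=> /INR_leq; rewrite !INR_addn => total.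
have G0 : 0 < INR (num_regular n d) by apply: lt_0_INR; apply/ltP.
rewrite /prob_Gnd -/(num_regular n d); apply: (Rmult_le_reg_r _ _ _ G0).
by rewrite /Rdiv Rmult_assoc Rinv_l; lra.
Qed.

End Main.

Theorem mainTheorem1 :
  forall eps : R, (0 < eps)%R ->
  exists d0 : nat, forall d : nat, (d0 <= d)%N ->
    aas d (fun n (g : graph n) =>
      Rleb (INR n * (1 - (1 + eps) * (4 * ln (INR d) / INR d)))%R
           (INR (zero_forcing_number g))
      && Rleb (INR (zero_forcing_number g))
              (INR n * (1 - (1 - eps) * (ln (INR d) / (2 * INR d))))%R).
Proof.
move=> eps eps0.
(* Shrinking epsilon only strengthens both bounds. *)
pose e := Rmin eps (1 / 2).
have e_le : (e <= eps /\ e <= 1 / 2)%R by split; [apply: Rmin_l|apply: Rmin_r].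
have e0 : (0 < e)%R by apply: Rmin_glb_lt; lra.
(* The constant 180 = 4 * 45 yields e l >= 180, so d >= l^2/4 gives e d >= 45 l; then 15 y <= e
   below, since 2(1 + e) <= 3. *)
have [D [_ Dhi]] := exists_nat_floor (Rlt_le _ _ (exp_pos (180 / e))).
exists D.+1 => d Dd eta eta0.
have d_ge : (exp (180 / e) <= INR d)%R by have := INR_leq Dd; rewrite S_INR; lra.
have d0 : (0 < INR d)%R by have := exp_pos (180 / e); lra.
set l := ln (INR d).
have expl : exp l = INR d by apply: exp_ln.
have l_ge : (180 / e <= l)%R.
  by apply: Rnot_lt_le => /exp_increasing; lra.
have l_ge' : (180 <= l * e)%R.
  by have := Rmult_le_compat_r e _ _ (Rlt_le _ _ e0) l_ge; rewrite /Rdiv Rmult_assoc Rinv_l; lra.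
have l360 : (360 <= l)%R by nra.
have dl : (45 * l <= e * INR d)%R.
  have l0 : (0 <= l)%R by lra.
  by have := exp_quadratic l0; rewrite expl; nra.
(* The hole size s will be the floor of y n. *)
pose y := (2 * (1 + e) * (l / INR d))%R.
have yd : (y * INR d = 2 * (1 + e) * l)%R by rewrite /y; field; lra.
have y0 : (0 < y)%R.
  by apply: (Rmult_lt_reg_r (INR d)) => //; rewrite yd; nra.
have ye : (15 * y <= e)%R.
  by apply: (Rmult_le_reg_r (INR d)) => //; rewrite Rmult_assoc yd; nra.
(* Chosen so that (1 - kappa)(2 + e/2) = 2. *)
pose kappa := (e / (4 + e))%R.
have kE : (kappa * (4 + e) = e)%R by rewrite /kappa; field; lra.
have k0 : (0 < kappa)%R by nra.
pose delta := (e / 2)%R.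
(* The summands of C, a lower bound for s, ensure rho >= 2, 3d <= y s and 108 / (kappa^2 rho) <=
   eta/2. N1 makes the Markov bound at delta n at most eta/2. *)
pose C := (2 + 3 * INR d / y + 216 / (kappa ^ 2 * eta))%R.
pose N1 := (4 * INR d ^ 3 * (INR d + 1) / (delta * eta))%R.
have C1 : (0 < 3 * INR d / y)%R by apply: Rdiv_lt_0_compat; lra.
have ke0 : (0 < kappa ^ 2 * eta)%R by apply: Rmult_lt_0_compat => //; apply: pow_lt.
have C2 : (0 < 216 / (kappa ^ 2 * eta))%R by apply: Rdiv_lt_0_compat; lra.
have de0 : (0 < delta * eta)%R by apply: Rmult_lt_0_compat => //; rewrite /delta; lra.
have d3 : (0 < INR d ^ 3)%R by apply: pow_lt.
have N1p : (0 < N1)%R by apply: Rdiv_lt_0_compat => //; apply: Rmult_lt_0_compat; lra.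
have Cy : (0 < (C + 1) / y)%R by apply: Rdiv_lt_0_compat; rewrite /C; lra.
have [N [_ Nhi]] := exists_nat_floor (x := ((C + 1) / y + N1)%R) ltac:(lra).
exists (maxn N.+1 (8 * d.+1)) => n; rewrite geq_max => /andP[Nn dn] even_nd.
have n_ge : ((C + 1) / y + N1 < INR n)%R by have := INR_leq Nn; rewrite S_INR; lra.
have nd : (INR d + 1 <= INR n)%R.
  by rewrite -S_INR; apply: INR_leq; lia.
have yn : (C + 1 <= y * INR n)%R.
  have : ((C + 1) / y <= INR n)%R by lra.
  move=> /(Rmult_le_compat_l _ _ _ (Rlt_le _ _ y0)).
  by have -> : (y * ((C + 1) / y) = C + 1)%R by field; lra.
have [s [slo shi]] := exists_nat_floor (x := (y * INR n)%R) ltac:(rewrite /C in yn; lra).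
have sC : (C <= INR s)%R by lra.
have reg0 : (0 < num_regular n d)%N.
  apply/card_gt0P; exists (circulant n d); rewrite inE; apply: circulant_regular => //; lia.
have G0 : (0 < INR (num_regular n d))%R by apply: lt_0_INR; apply/ltP.
have n0 : (0 < INR n)%R by lra.
apply: (prob_Gnd_lower (Q1 := has_hole s)
  (Q2 := fun g => ~~ Rleb (INR #|[set v | on_short_cycle g v]|) (delta * INR n))) => //.
- move=> g reg; have [//|noh] := boolP (has_hole s g); first by rewrite orbT.
  have [/RlebP few|//] := boolP (Rleb (INR #|_|) _); last by rewrite orbT.
  rewrite !orbF; apply/andP; split; apply/RlebP.
    apply: Rle_trans (zero_forcing_lower slo _ noh); last lra.
    apply: Rmult_le_compat_l; first lra.
    have -> : (2 * y = (1 + e) * (4 * l / INR d))%R by rewrite /y; field; lra.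
    suff : ((1 + e) * (4 * l / INR d) <= (1 + eps) * (4 * l / INR d))%R by rewrite /l; lra.
    by apply: Rmult_le_compat_r; [apply/Rlt_le/Rdiv_lt_0_compat|]; lra.
  apply: Rle_trans (zero_forcing_upper (delta := delta) reg _ _ _ _ few) _.
  + lia.
  + by rewrite /delta; lra.
  + rewrite -/l; apply: Rle_trans l_ge; have inv_e := Rinv_0_lt_compat _ e0.
    by have -> : (4 / delta = 8 * / e)%R by [rewrite /delta; field; lra]; lra.
  + by rewrite -/l; nra.
  apply: Rmult_le_compat_l; first lra.
  rewrite -/l; suff : ((1 - eps) * (l / (2 * INR d)) <= (1 - delta) ^ 2 * (l / (2 * INR d)))%R by lra.
  apply: Rmult_le_compat_r; first by apply/Rlt_le/Rdiv_lt_0_compat; lra.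
  by rewrite /delta /=; nra.
- have s0 : (0 < INR s)%R by rewrite /C in sC; lra.
  (* Then nd rho = (1 - 5y)(sd)^2, and the spare 5y (sd)^2 covers the other three terms of [quad],
     which need at most 4y (sd)^2. *)
  pose rho := ((1 - 5 * y) * INR d * INR s * (INR s / INR n))%R.
  have sn : (INR s / INR n <= y)%R.
    by apply: (Rmult_le_reg_r _ _ _ n0); rewrite /Rdiv Rmult_assoc Rinv_l; lra.
  have sn0 : (0 < INR s / INR n)%R by apply: Rdiv_lt_0_compat.
  (* Rounding y n down to s costs at most d/n <= 1. *)
  have dsn : (2 * (1 + e) * l - 1 <= INR d * (INR s / INR n))%R.
    apply: (Rmult_le_reg_r _ _ _ n0).
    have -> : (INR d * (INR s / INR n) * INR n = INR d * INR s)%R by field; lra.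
    have : (INR d * (y * INR n) <= INR d * (INR s + 1))%R by apply: Rmult_le_compat_l; lra.
    have -> : (INR d * (y * INR n) = y * INR d * INR n)%R by ring.
    by rewrite yd; nra.
  (* Since 5y <= e/3, the factor of s is at least (1 - e/3)(2(1 + e) l - 1); the surplus over 2l
     exceeds e l/2 because e l >= 180. *)
  have rho_s : ((2 + e / 2) * l * INR s <= rho)%R.
    have -> : (rho = (1 - 5 * y) * (INR d * (INR s / INR n)) * INR s)%R by rewrite /rho; ring.
    apply: Rmult_le_compat_r; first lra.
    apply: (Rle_trans _ ((1 - 5 * y) * (2 * (1 + e) * l - 1))); last by apply: Rmult_le_compat_l; lra.
    have : ((1 - e / 3) * (2 * (1 + e) * l - 1) <= (1 - 5 * y) * (2 * (1 + e) * l - 1))%R.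
      by apply: Rmult_le_compat_r; nra.
    by nra.
  have s_rho : (INR s <= rho)%R by apply: Rle_trans rho_s; nra.
  have s2 : (2 <= INR s)%R by rewrite /C in sC; lra.
  have rho_le : (rho <= y * INR d * INR s)%R.
    have ds0 : (0 <= INR d * INR s)%R by nra.
    have -> : (rho = INR d * INR s * ((1 - 5 * y) * (INR s / INR n)))%R by rewrite /rho; ring.
    have -> : (y * INR d * INR s = INR d * INR s * y)%R by ring.
    apply: Rmult_le_compat_l => //.
    by move: (INR s / INR n)%R sn sn0 => q *; nra.
  have Eq : (INR n * INR d * rho = (1 - 5 * y) * (INR s * INR d) ^ 2)%R by rewrite /rho; field; lra.
  have ds3 : (3 * INR s * INR d ^ 3 <= y * (INR s * INR d) ^ 2)%R.
    have : (3 * INR d <= y * INR s)%R.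
      have : (3 * INR d / y <= INR s)%R by rewrite /C in sC; lra.
      move=> /(Rmult_le_compat_l _ _ _ (Rlt_le _ _ y0)).
      by have -> : (y * (3 * INR d / y) = 3 * INR d)%R by field; lra.
    have p : (0 <= INR s * INR d ^ 2)%R by apply: Rmult_le_pos; [lra|apply: pow2_ge_0].
    by move=> /(Rmult_le_compat_r _ _ _ p); rewrite /=; lra.
  have quad : (INR n * INR d * rho + 2 * rho ^ 2 + 2 * rho * (INR s * INR d) + 3 * INR s * INR d ^ 3
      <= (INR s * INR d) ^ 2)%R.
    rewrite Eq; move: ds3; set X := (INR s * INR d)%R => ds3.
    have rX : (rho <= y * X)%R by rewrite /X; lra.
    have X0 : (0 <= X)%R by apply: Rmult_le_pos; lra.
    have h1 : (rho * X <= y * X ^ 2)%R by have := Rmult_le_compat_r _ _ _ X0 rX; rewrite /=; lra.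
    have h2 : (rho ^ 2 <= rho * X * (1 / 2))%R.
      have : (rho <= X * (1 / 2))%R.
        by apply: Rle_trans rX _; rewrite Rmult_comm; apply: Rmult_le_compat_l; lra.
      by have r0 : (0 <= rho)%R by [lra]; move=> /(Rmult_le_compat_l _ _ _ r0); rewrite /=; lra.
    have h3 : (0 <= y * X ^ 2)%R by apply: Rmult_le_pos; [lra|apply: pow2_ge_0].
    lra.
  have en : (exp 1 * INR n <= INR d * INR s)%R.
    have ds : (3 * INR n <= INR d * INR s)%R.
      have := Rmult_le_compat_r _ _ _ (Rlt_le _ _ n0) dsn.
      have -> : (INR d * (INR s / INR n) * INR n = INR d * INR s)%R by field; lra.
      apply: Rle_trans; apply: Rmult_le_compat_r; lra.
    by have := Rmult_le_compat_r _ _ _ (Rlt_le _ _ n0) exp_le_3; lra.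
  have slr : (2 * INR s * ln (INR d) <= (1 - kappa) * rho)%R.
    rewrite -/l; have k1 : (0 <= 1 - kappa)%R.
      by apply: (Rmult_le_reg_r (4 + e)); lra.
    have := Rmult_le_compat_l _ _ _ k1 rho_s.
    have -> : ((1 - kappa) * ((2 + e / 2) * l * INR s) = 2 * INR s * l)%R by rewrite /kappa; field; lra.
    by [].
  have holes := has_hole_upper (Rle_trans _ _ _ s2 s_rho) k0 quad en d0 slr.
  have k2 : (0 < kappa ^ 2)%R by apply: pow_lt.
  have kr : (216 / eta <= kappa ^ 2 * rho)%R.
    have sge : (216 / (kappa ^ 2 * eta) <= rho)%R by rewrite /C in sC; lra.
    have := Rmult_le_compat_l _ _ _ (Rlt_le _ _ k2) sge.
    by have -> : (kappa ^ 2 * (216 / (kappa ^ 2 * eta)) = 216 / eta)%R by field; lra.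
  have eta_pos : (0 < 216 / eta)%R by apply: Rdiv_lt_0_compat; lra.
  apply: (Rmult_le_reg_r _ _ _ eta_pos).
  have -> : (eta / 2 * INR (num_regular n d) * (216 / eta) = 108 * INR (num_regular n d))%R by field; lra.
  apply: Rle_trans holes; apply: Rmult_le_compat_l => //; exact: pos_INR.
have t0 : (0 < delta * INR n)%R by apply: Rmult_lt_0_compat => //; rewrite /delta; lra.
have d_gt0 : (0 < d)%N by apply/ltP/INR_lt.
have few := many_on_short_cycle_upper t0 d_gt0 dn.
apply: (Rmult_le_reg_r _ _ _ t0); apply: Rle_trans few _.
rewrite (Rmult_comm (eta / 2)) !Rmult_assoc; apply: Rmult_le_compat_l; first lra.
have : (N1 <= INR n)%R by lra.
move=> /(Rmult_le_compat_l _ _ _ (Rlt_le _ _ de0)).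
have -> : (delta * eta * N1 = 4 * INR d ^ 3 * (INR d + 1))%R.
  by rewrite /N1; field; rewrite /delta; lra.
rewrite /delta /=; lra.
Qed.
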